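(* Consider the equation $$X^{\nu}=kX^{\mu}+X+l,$$ with $\nu>\mu$ and $|k|,|l|,|kl^{-1}|<1$. Set $k_1=\frac{\nu}{\nu-1}$, $\lambda_1=\frac{-\mu}{\nu-1}$, $$\mathbf{f}(s;x):=\sum_{n=1}^{\infty}\binom{s}{n}\binom{k_1s+\lambda_1n}{s}\frac{n}{(s-n+1)(k_1 s+\lambda_1n)}x^n$$ and $$\mathbf{g}(w):=w+w\lambda_1\sum_{s=0}^{\infty}(-1)^s\,\mathbf{f}\left(s;kw^{-1}\right)w^s.$$ Then a solution of the equation is $$X_2=\mathbf{BR}_{\nu}\left(\mathbf{g}(l)\right).$$
   Context: For complex $z$ and integer $n\ge 0$, $\binom{z}{n}=\frac{\Gamma(z+1)}{\Gamma(n+1)\Gamma(z-n+1)}$. The $\nu$-th order Bring radical $\mathbf{BR}_\nu(a)$ is the solution $X$ of $X^\nu=X+a$ given by $$\mathbf{BR}_{\nu}(a)=\left(\sum_{n=0}^{\infty}\binom{\frac{\nu n+1}{\nu-1}}{n}\frac{(-a)^n}{\nu n+1}\right)^{-1}.$$ Indeterminate quotients in $\mathbf{f}$ are read by continuity: for integer $s\ge 0$, $\binom{s}{n}\frac{1}{s-n+1}$ means $\frac{s!}{n!\,(s-n+1)!}$ for $1\le n\le s+1$ (so it equals $\frac{1}{s+1}$ at $n=s+1$) and $0$ for $n>s+1$; likewise $\binom{z}{s}\frac1z$ at $z=0$, $s\ge1$, means its limit as $z\to 0$.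
   Formalization: Added to mend a false claim: the series for g(l) and BR_ν(g(l)) converge, and for 0<t<1 g at (tk,tl) stays in the open convergence disc of BR_ν; both shown for small k,l. Also ν,μ are integers with μ≥1, and l≠0. *)

(* Defs.v *)
From Stdlib Require Import Reals Factorial.
From Coquelicot Require Import Coquelicot.
Open Scope R_scope.

(* Gauss' product  lim_N N! N^x / (x (x+1) ... (x+N)).  At the poles
   x = 0, -1, -2, ... the denominators vanish from some N on, so the value
   there is the default 0. *)
Definition Gamma (x : R) : R :=
  real (Lim_seq (fun N : nat =>
    INR (fact N) * Rpower (INR N) x / prod_f_R0 (fun j => x + INR j) N)).

(* The limit extends the Gamma quotient continuously to the negative integers
   z, where it is undefined; elsewhere the limit is the value.  All upper
   arguments met below are rational, so real z suffice. *)
Definition gbinom (z : R) (n : nat) : R :=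
  real (Lim (fun w =>
    Gamma (w + 1) / (Gamma (INR n + 1) * Gamma (w - INR n + 1))) z).

(* binom(z, s) / z, by continuity at z = 0 (the limit is finite for s >= 1). *)
Definition gbinom_div (z : R) (s : nat) : R :=
  if Req_EM_T z 0
  then real (Lim (fun w => gbinom w s / w) 0)
  else gbinom z s / z.

(* binom(s, n) / (s - n + 1) for integers s >= 0, n >= 1, by continuity in s:
   s! / (n! (s - n + 1)!) if n <= s + 1, and 0 if n > s + 1. *)
Definition binom_div_succ (s n : nat) : R :=
  if Nat.leb n (s + 1)
  then INR (fact s) / (INR (fact n) * INR (fact (s + 1 - n)))
  else 0.

Definition CSeries (u : nat -> C) : C :=
  (Series (fun n => Re (u n)), Series (fun n => Im (u n))).

Definition ex_Cseries (u : nat -> C) : Prop :=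
  @ex_series C_AbsRing C_NormedModule u.

Definition BR_coef (nu n : nat) : R :=
  gbinom ((INR nu * INR n + 1) / (INR nu - 1)) n / (INR nu * INR n + 1).

Definition BR_term (nu : nat) (a : C) (n : nat) : C :=
  (RtoC (BR_coef nu n) * (- a) ^ n)%C.

Definition BR (nu : nat) (a : C) : C := (/ CSeries (BR_term nu a))%C.

Definition k1 (nu : nat) : R := INR nu / (INR nu - 1).

Definition lambda1 (nu mu : nat) : R := - INR mu / (INR nu - 1).

Definition f_coef (nu mu s n : nat) : R :=
  binom_div_succ s n
  * gbinom_div (k1 nu * INR s + lambda1 nu mu * INR n) s
  * INR n.

Definition f (nu mu s : nat) (x : C) : C :=
  CSeries (fun m => RtoC (f_coef nu mu s (S m)) * x ^ S m)%C.

Definition g_term (nu mu : nat) (k w : C) (s : nat) : C :=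
  ((- RtoC 1) ^ s * f nu mu s (k * / w) * w ^ s)%C.

Definition g (nu mu : nat) (k w : C) : C :=
  (w + w * RtoC (lambda1 nu mu) * CSeries (g_term nu mu k w))%C.

(* Both series in BR nu (g nu mu k l) converge. *)
Definition X2_defined (nu mu : nat) (k l : C) : Prop :=
  ex_Cseries (g_term nu mu k l) /\ ex_Cseries (BR_term nu (g nu mu k l)).

(* Along the segment from (0, 0) to (k, l) the argument of BR nu does not leave
   the open disc of convergence of its defining series.  Without this, the
   continuation of the root from X = 1 at (0, 0) may turn around a branch point
   of X^nu = X + a, and the sum of the BR series at the end point is then
   another root of X^nu = X + a.  For nu = 2, mu = 1, k = -0.16335,
   l = -0.17015625 both series converge absolutely, but BR nu (g nu mu k l) is
   not a root of X^2 = k X + X + l. *)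
Definition principal_branch (nu mu : nat) (k l : C) : Prop :=
  forall t : R, 0 < t < 1 ->
    Rbar_lt (Cmod (g nu mu (RtoC t * k) (RtoC t * l))) (CV_radius (BR_coef nu)).

(* Main.v *)
(**
Put V = X^(1-nu), r = nu/(nu-1), q = (nu-mu)/(nu-1), a = -l, b = -k.  The equation
becomes V = 1 + a V^r + b V^q near V = 1, and every power V^x has an explicit double
power series in (a, b) whose coefficients are polynomials in x; the Rothe-Hagen
identity V^x V^y = V^(x+y) holds formally.  The series of l + k X^mu = l + k V^lambda_1
is exactly g(l), and X^nu = X + g(l) is the Bring equation, so that for small (k, l)
the root near 1 is BR_nu(g(l)).

For general (k, l), follow the segment t -> (t k, t l).  While g stays in the disc of
convergence of the BR series, 1/BR_nu(g) is an analytic function of t, and the equation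
for small t propagates by the identity theorem.  The BR coefficients are nonnegative and
Y = 1/BR_nu(-t) satisfies Y^(nu-1) = 1 + t Y^nu, which forces t Y <= 1; hence the BR
series converges absolutely on its closed disc, and t -> 1 is justified by Abel's theorem
for g and dominated convergence for BR.
*)

Require Import Defs.
From Stdlib Require Import Reals Lra Lia ZArith Classical.
From Coquelicot Require Import Coquelicot.
Open Scope R_scope.

(** * The Rothe-Hagen identity *)

(** Everything is stated for Y = 1/X, where the equation is polynomial in Y and the root at the
    origin is Y = 1. Only the real parameter t moves along the segment, so analyticity is needed in
    one real variable and is taken to mean a local power series; products and compositions are then
    rearrangements of absolutely convergent double series. Grading V^x by total degree in (a, b)
    turns its double series into a single power series in t. The formal identities do not tell which
    root the Bring series selects. This is settled near t = 0: the sum of V^(1/(nu-1)) and the Bring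
    series at -g both satisfy y^(nu-1) + g y^nu = 1 and both equal 1 at t = 0. The difference
    quotient of this equation has the value nu - 1 there, so the two functions coincide nearby. The
    constant exp 3 in the convergence estimates is crude; they only have to give some positive
    radius, since the identity theorem carries the equation further. *)

Fixpoint Csum (u : nat -> C) (n : nat) : C :=
  match n with
  | O => RtoC 0
  | S n => (Csum u n + u n)%C
  end.

Lemma Csum_ext (u v : nat -> C) (n : nat) :
  (forall i, (i < n)%nat -> u i = v i) -> Csum u n = Csum v n.
Proof.
  induction n as [|n IH]; intros H; simpl; [easy|].
  rewrite IH, H by (intros; try apply H; lia). easy.
Qed.

Lemma Csum_plus (u v : nat -> C) (n : nat) :
  Csum (fun i => u i + v i)%C n = (Csum u n + Csum v n)%C.
Proof. induction n as [|n IH]; simpl; [|rewrite IH]; ring. Qed.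

Lemma Csum_scal (c : C) (u : nat -> C) (n : nat) :
  Csum (fun i => c * u i)%C n = (c * Csum u n)%C.
Proof. induction n as [|n IH]; simpl; [|rewrite IH]; ring. Qed.

Lemma Csum_zero (u : nat -> C) (n : nat) :
  (forall i, (i < n)%nat -> u i = RtoC 0) -> Csum u n = RtoC 0.
Proof.
  intros H; induction n as [|n IH]; simpl; [easy|].
  rewrite IH, H by (intros; try apply H; lia). ring.
Qed.

Lemma Csum_S_l (u : nat -> C) (n : nat) :
  Csum u (S n) = (u O + Csum (fun i => u (S i)) n)%C.
Proof.
  induction n as [|n IH]; [simpl; ring|].
  change (Csum u (S (S n))) with (Csum u (S n) + u (S n))%C.
  rewrite IH; simpl; ring.
Qed.

Definition conv (a b : nat -> C) (n : nat) : C :=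
  Csum (fun i => a i * b (n - i)%nat)%C (S n).

(* d is the number of coefficients, not the degree. *)
Fixpoint poly_fun (d : nat) (f : R -> C) : Prop :=
  match d with
  | O => forall x, f x = RtoC 0
  | S d => exists (c : C) (g : R -> C),
      poly_fun d g /\ forall x, f x = (c + RtoC x * g x)%C
  end.

Lemma poly_fun_ext (d : nat) (f g : R -> C) :
  (forall x, f x = g x) -> poly_fun d f -> poly_fun d g.
Proof.
  destruct d as [|d]; simpl; intros H.
  - intros Hf x. now rewrite <- H.
  - intros (c & h & Hh & E). exists c, h. split; [easy|].
    intros x. now rewrite <- H.
Qed.

Lemma poly_fun_S (d : nat) (f : R -> C) : poly_fun d f -> poly_fun (S d) f.
Proof.
  revert f; induction d as [|d IH]; intros f.
  - intros H. exists (RtoC 0), (fun _ => RtoC 0). split; [easy|].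
    intros x. simpl in H. rewrite H. ring.
  - intros (c & g & Hg & E). exists c, g. split; [apply IH|]; easy.
Qed.

Lemma poly_fun_le (d e : nat) (f : R -> C) :
  (d <= e)%nat -> poly_fun d f -> poly_fun e f.
Proof.
  induction 1 as [|e H IH]; intros Hf; [easy|]. now apply poly_fun_S, IH.
Qed.

Lemma poly_fun_const (c : C) : poly_fun 1 (fun _ => c).
Proof.
  exists c, (fun _ => RtoC 0). split; [easy|]. intros x. ring.
Qed.

Lemma poly_fun_plus (d : nat) (f g : R -> C) :
  poly_fun d f -> poly_fun d g -> poly_fun d (fun x => f x + g x)%C.
Proof.
  revert f g; induction d as [|d IH]; intros f g.
  - simpl. intros Hf Hg x. rewrite Hf, Hg. ring.
  - intros (c & f' & Hf & Ef) (c' & g' & Hg & Eg).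
    exists (c + c')%C, (fun x => f' x + g' x)%C. split; [now apply IH|].
    intros x. rewrite Ef, Eg. ring.
Qed.

Lemma poly_fun_scal (d : nat) (a : C) (f : R -> C) :
  poly_fun d f -> poly_fun d (fun x => a * f x)%C.
Proof.
  revert f; induction d as [|d IH]; intros f.
  - simpl. intros Hf x. rewrite Hf. ring.
  - intros (c & f' & Hf & Ef).
    exists (a * c)%C, (fun x => a * f' x)%C. split; [now apply IH|].
    intros x. rewrite Ef. ring.
Qed.

Lemma poly_fun_mul_lin (d : nat) (b : R) (f : R -> C) :
  poly_fun d f -> poly_fun (S d) (fun x => RtoC (x + b) * f x)%C.
Proof.
  intros H.
  apply (poly_fun_ext _ (fun x => RtoC x * f x + RtoC b * f x)%C).
  { intros x. rewrite RtoC_plus. ring. }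
  apply poly_fun_plus.
  - exists (RtoC 0), f. split; [easy|]. intros x. ring.
  - now apply poly_fun_S, poly_fun_scal.
Qed.

Lemma poly_fun_Csum (d n : nat) (F : nat -> R -> C) :
  (forall i, (i < n)%nat -> poly_fun d (F i)) ->
  poly_fun d (fun x => Csum (fun i => F i x) n).
Proof.
  induction n as [|n IH]; intros H; simpl.
  - apply (poly_fun_le 0); [lia|easy].
  - apply poly_fun_plus; [apply IH; intros; apply H; lia|apply H; lia].
Qed.

(** Synthetic division along the Horner form: if h(x) = h(a) + (x - a) h'(x), then c + x h(x) = c +
    a h(a) + (x - a) (h(a) + x h'(x)). *)
Lemma poly_fun_factor (d : nat) (f : R -> C) (a : R) :
  poly_fun (S d) f ->
  exists g, poly_fun d g /\ forall x, f x = (f a + RtoC (x - a) * g x)%C.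
Proof.
  revert f; induction d as [|d IH]; intros f (c & h & Hh & E).
  - exists h. split; [easy|]. simpl in Hh.
    intros x. rewrite !E, !Hh. ring.
  - destruct (IH h Hh) as (h' & Hh' & E').
    exists (fun x => h a + RtoC x * h' x)%C. split.
    + exists (h a), h'. easy.
    + intros x. rewrite !E, E', RtoC_minus. ring.
Qed.

(** Each zero splits off a linear factor and lowers the number of coefficients. Asking for zeros at
    all n >= N lets the induction go on with [S N] after the zero N is used up. *)
Lemma poly_fun_eq_0 (d : nat) (f : R -> C) (N : nat) :
  poly_fun d f -> (forall n, (N <= n)%nat -> f (INR n) = RtoC 0) ->
  forall x, f x = RtoC 0.
Proof.
  revert f N; induction d as [|d IH]; intros f N Hf H0; [easy|].
  destruct (poly_fun_factor d f (INR N) Hf) as (g & Hg & E).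
  rewrite (H0 N) in E by lia.
  assert (G : forall x, g x = RtoC 0).
  { apply (IH g (S N) Hg). intros n Hn.
    pose proof (H0 n ltac:(lia)) as Hz. rewrite E in Hz.
    destruct (Ceq_dec (g (INR n)) (RtoC 0)) as [e|e]; [easy|].
    exfalso. apply (Cmult_neq_0 (RtoC (INR n - INR N)) (g (INR n))); [|easy|].
    - intros K. apply RtoC_inj in K. apply Rminus_diag_uniq, INR_eq in K. lia.
    - rewrite <- Hz. ring. }
  intros x. rewrite E, G. ring.
Qed.

(** * Falling factorials and the formal powers of V *)

Fixpoint falling (z : R) (n : nat) : R :=
  match n with
  | O => 1
  | S n => z * falling (z - 1) n
  end.

Lemma falling_S_r (z : R) (n : nat) :
  falling z (S n) = falling z n * (z - INR n).
Proof.
  revert z; induction n as [|n IH]; intros z; [simpl; ring|].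
  change (z * falling (z - 1) (S n) = z * falling (z - 1) n * (z - INR (S n))).
  rewrite IH, S_INR. ring.
Qed.

(* Coefficient of a^i b^j in V^x, where V = 1 + a V^r + b V^q. *)
Definition Vcoef (r q : R) (i j : nat) (x : R) : R :=
  match (i + j)%nat with
  | O => 1
  | S m => x * falling (x + r * INR i + q * INR j - 1) m
           / (INR (fact i) * INR (fact j))
  end.

(* The part of V^x that is homogeneous of degree m in (a, b). *)
Definition Vhom (r q : R) (a b : C) (m : nat) (x : R) : C :=
  Csum (fun j => RtoC (Vcoef r q (m - j) j x) * (a ^ (m - j) * b ^ j))%C (S m).

Lemma Vhom_O (r q : R) (a b : C) (x : R) : Vhom r q a b 0 x = RtoC 1.
Proof. unfold Vhom, Vcoef. simpl. ring. Qed.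

(** Formally V^0 = 1: the factor x of [Vcoef] kills every positive degree. *)
Lemma Vhom_S_0 (r q : R) (a b : C) (m : nat) : Vhom r q a b (S m) 0 = RtoC 0.
Proof.
  apply Csum_zero. intros j Hj. unfold Vcoef.
  replace (S m - j + j)%nat with (S m) by lia.
  unfold Rdiv. rewrite !Rmult_0_l. ring.
Qed.

(** Multiplication by a variable, seen on coefficients. The value 0 at index 0 absorbs the boundary
    cases of the recurrence for [Vcoef]. *)
Definition shl (f : nat -> R) (i : nat) : R :=
  match i with O => 0 | S i => f i end.

(** Coefficientwise V^(x+1) = V^x V = V^x + a V^(x+r) + b V^(x+q). Put z = x + r i + q j and m = i +
    j - 1. For m >= 1 all terms share the factor [falling (z - 1) (m - 1)], and what remains is (x +
    1) z = x (z - m) + i (x + r) + j (x + q). *)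
Lemma Vcoef_diff (r q : R) (i j : nat) (x : R) : (0 < i + j)%nat ->
  Vcoef r q i j (x + 1) =
  Vcoef r q i j x + shl (fun i => Vcoef r q i j (x + r)) i
    + shl (fun j => Vcoef r q i j (x + q)) j.
Proof.
  intros H.
  assert (F : forall n, INR (fact n) <> 0) by exact INR_fact_neq_0.
  assert (P : forall n, INR n + 1 <> 0).
  { intros n. pose proof (pos_INR n). lra. }
  destruct i as [|i], j as [|j]; [lia| | |]; unfold Vcoef, shl;
    rewrite ?Nat.add_0_r, ?Nat.add_succ_r, ?Nat.add_0_l; cbn [Nat.add].
  - destruct j as [|j].
    + simpl. field.
    + replace (x + 1 + r * INR 0 + q * INR (S (S j)) - 1)
        with (x + r * INR 0 + q * INR (S (S j))) by ring.
      replace (x + q + r * INR 0 + q * INR (S j) - 1)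
        with (x + r * INR 0 + q * INR (S (S j)) - 1)
        by (rewrite (S_INR (S j)); ring).
      rewrite (falling_S_r (_ - 1)).
      change (falling (x + r * INR 0 + q * INR (S (S j))) (S j)) with
        ((x + r * INR 0 + q * INR (S (S j)))
         * falling (x + r * INR 0 + q * INR (S (S j)) - 1) j).
      set (Z := falling _ j).
      change (fact (S (S j))) with (S (S j) * fact (S j))%nat.
      rewrite mult_INR, !S_INR. specialize (P (S j)). rewrite S_INR in P.
      simpl (INR 0). simpl (INR (fact 0)).
      field. split; [apply F|exact P].
  - destruct i as [|i].
    + simpl. field.
    + replace (x + 1 + r * INR (S (S i)) + q * INR 0 - 1)
        with (x + r * INR (S (S i)) + q * INR 0) by ring.
      replace (x + r + r * INR (S i) + q * INR 0 - 1)
        with (x + r * INR (S (S i)) + q * INR 0 - 1)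
        by (rewrite (S_INR (S i)); ring).
      rewrite (falling_S_r (_ - 1)).
      change (falling (x + r * INR (S (S i)) + q * INR 0) (S i)) with
        ((x + r * INR (S (S i)) + q * INR 0)
         * falling (x + r * INR (S (S i)) + q * INR 0 - 1) i).
      set (Z := falling _ i).
      change (fact (S (S i))) with (S (S i) * fact (S i))%nat.
      rewrite mult_INR, !S_INR. specialize (P (S i)). rewrite S_INR in P.
      simpl (INR 0). simpl (INR (fact 0)).
      field. split; [apply F|exact P].
  - replace (x + 1 + r * INR (S i) + q * INR (S j) - 1)
      with (x + r * INR (S i) + q * INR (S j)) by ring.
    replace (x + r + r * INR i + q * INR (S j) - 1)
      with (x + r * INR (S i) + q * INR (S j) - 1)
      by (rewrite (S_INR i); ring).
    replace (x + q + r * INR (S i) + q * INR j - 1)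
      with (x + r * INR (S i) + q * INR (S j) - 1)
      by (rewrite (S_INR j); ring).
    rewrite (falling_S_r (_ - 1)).
    change (falling (x + r * INR (S i) + q * INR (S j)) (S (i + j))) with
      ((x + r * INR (S i) + q * INR (S j))
       * falling (x + r * INR (S i) + q * INR (S j) - 1) (i + j)).
    set (Z := falling _ (i + j)).
    change (fact (S i)) with (S i * fact i)%nat.
    change (fact (S j)) with (S j * fact j)%nat.
    rewrite !mult_INR, !S_INR, plus_INR.
    field. repeat split; auto.
Qed.

Lemma Vhom_diff (r q : R) (a b : C) (m : nat) (x : R) :
  Vhom r q a b (S m) (x + 1) =
  (Vhom r q a b (S m) x + a * Vhom r q a b m (x + r)
     + b * Vhom r q a b m (x + q))%C.
Proof.
  unfold Vhom.
  rewrite (Csum_ext _ (fun j =>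
    RtoC (Vcoef r q (S m - j) j x) * (a ^ (S m - j) * b ^ j)
    + RtoC (shl (fun i => Vcoef r q i j (x + r)) (S m - j)) * (a ^ (S m - j) * b ^ j)
    + RtoC (shl (fun j' => Vcoef r q (S m - j) j' (x + q)) j) * (a ^ (S m - j) * b ^ j))%C).
  2:{ intros j Hj. rewrite Vcoef_diff by lia. rewrite !RtoC_plus. ring. }
  rewrite !Csum_plus. f_equal; [f_equal|].
  (* The sum coming from a loses its last index j = [S m], where the exponent of a is 0; the sum
     coming from b, in the next case, loses its first. *)
  - set (u := fun j => _). change (Csum u (S (S m))) with (Csum u (S m) + u (S m))%C.
    subst u. cbv beta. rewrite Nat.sub_diag.
    simpl (shl _ 0). rewrite <- Csum_scal, !Cmult_0_l, Cplus_0_r.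
    apply Csum_ext. intros j Hj.
    replace (S m - j)%nat with (S (m - j)) by lia. simpl. ring.
  - rewrite Csum_S_l. simpl (shl _ 0). rewrite <- Csum_scal, !Cmult_0_l, Cplus_0_l.
    apply Csum_ext. intros j Hj. simpl. ring.
Qed.

Lemma poly_fun_falling (m : nat) (c : R) :
  poly_fun (S m) (fun x => RtoC (falling (x + c) m)).
Proof.
  revert c; induction m as [|m IH]; intros c; [apply (poly_fun_const (RtoC 1))|].
  apply (poly_fun_ext _ (fun x => RtoC (x + c) * RtoC (falling (x + (c - 1)) m))%C).
  { intros x. replace (x + (c - 1)) with (x + c - 1) by ring.
    now rewrite <- RtoC_mult. }
  now apply poly_fun_mul_lin.
Qed.

Lemma poly_fun_Vcoef (r q : R) (i j : nat) (y : R) :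
  poly_fun (S (i + j)) (fun x => RtoC (Vcoef r q i j (x + y))).
Proof.
  unfold Vcoef. destruct (i + j)%nat as [|m]; [apply (poly_fun_const (RtoC 1))|].
  apply (poly_fun_ext _ (fun x => RtoC (/ (INR (fact i) * INR (fact j))) *
    (RtoC (x + y) * RtoC (falling (x + (y + r * INR i + q * INR j - 1)) m)))%C).
  { intros x. rewrite <- !RtoC_mult.
    replace (x + (y + r * INR i + q * INR j - 1))
      with (x + y + r * INR i + q * INR j - 1) by ring.
    f_equal. unfold Rdiv. ring. }
  now apply poly_fun_scal, poly_fun_mul_lin, poly_fun_falling.
Qed.

Lemma poly_fun_Vhom (r q : R) (a b : C) (m : nat) (y : R) :
  poly_fun (S m) (fun x => Vhom r q a b m (x + y)).
Proof.
  apply poly_fun_Csum. intros j Hj.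
  apply (poly_fun_ext _ (fun x => (a ^ (m - j) * b ^ j)
    * RtoC (Vcoef r q (m - j) j (x + y)))%C); [intros; ring|].
  apply poly_fun_scal.
  replace m with ((m - j) + j)%nat at 1 by lia. apply poly_fun_Vcoef.
Qed.

(* Rothe-Hagen: V^x V^y = V^(x+y).  The defect is a polynomial in x that vanishes
   at 0 and, by induction on the degree, is 1-periodic. *)
Lemma Vhom_conv (r q : R) (a b : C) (x y : R) (n : nat) :
  conv (fun m => Vhom r q a b m x) (fun m => Vhom r q a b m y) n
  = Vhom r q a b n (x + y).
Proof.
  revert x; induction n as [|n IH]; intros x.
  - unfold conv. simpl. rewrite !Vhom_O. ring.
  - set (D := fun x => (conv (fun m => Vhom r q a b m x)
                         (fun m => Vhom r q a b m y) (S n)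
                       + (- RtoC 1) * Vhom r q a b (S n) (x + y))%C).
    assert (HD : poly_fun (S (S n)) D).
    { apply poly_fun_plus; [|apply poly_fun_scal, poly_fun_Vhom].
      unfold conv. apply poly_fun_Csum. intros i Hi.
      apply (poly_fun_ext _ (fun x => Vhom r q a b (S n - i) y
                                      * Vhom r q a b i (x + 0))%C).
      { intros z. rewrite Rplus_0_r. ring. }
      apply poly_fun_scal, (poly_fun_le (S i)); [lia|apply poly_fun_Vhom]. }
    (* The head terms agree because degree 0 is constantly 1. In the others, differencing in x
       lowers the degree by one, and the induction hypothesis applies at z + r and z + q. *)
    assert (Hper : forall x, D (x + 1) = D x).
    { intros z. unfold D, conv. rewrite !(Csum_S_l _ (S n)), !Vhom_O.
      rewrite (Csum_ext _ (fun i =>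
        Vhom r q a b (S i) z * Vhom r q a b (S n - S i) y
        + a * (Vhom r q a b i (z + r) * Vhom r q a b (n - i) y)
        + b * (Vhom r q a b i (z + q) * Vhom r q a b (n - i) y))%C).
      2:{ intros i Hi. rewrite Vhom_diff. simpl (S n - S i)%nat. ring. }
      rewrite !Csum_plus, !Csum_scal.
      pose proof (IH (z + r)) as H1. pose proof (IH (z + q)) as H2.
      unfold conv in H1, H2. rewrite H1, H2.
      replace (z + 1 + y) with (z + y + 1) by ring.
      replace (z + r + y) with (z + y + r) by ring.
      replace (z + q + y) with (z + y + q) by ring.
      rewrite Vhom_diff. ring. }
    assert (H0 : D 0 = RtoC 0).
    { unfold D, conv. rewrite (Csum_S_l _ (S n)), Csum_zero, Vhom_O, Rplus_0_l.
      - simpl (S n - 0)%nat. ring.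
      - intros i Hi. rewrite Vhom_S_0. ring. }
    assert (HN : forall m, D (INR m) = RtoC 0).
    { induction m as [|m IHm]; [easy|]. rewrite S_INR, Hper. exact IHm. }
    pose proof (poly_fun_eq_0 _ D 0 HD (fun m _ => HN m) x) as E.
    unfold D in E.
    replace (Vhom r q a b (S n) (x + y)) with
      (Vhom r q a b (S n) (x + y) + RtoC 0)%C by ring.
    rewrite <- E. ring.
Qed.

(** * Absolutely convergent complex series *)

Lemma ex_series_le_R (a b : nat -> R) :
  (forall n, Rabs (a n) <= b n) -> ex_series b -> ex_series a.
Proof. exact (@ex_series_le R_AbsRing R_CompleteNormedModule a b). Qed.

Lemma ex_series_nonneg_bounded (a : nat -> R) (M : R) :
  (forall n, 0 <= a n) -> (forall N, sum_n a N <= M) ->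
  ex_series a /\ Series a <= M.
Proof.
  intros Ha HM.
  assert (Hinc : forall n, sum_n a n <= sum_n a (S n)).
  { intros n. rewrite sum_Sn. unfold plus; simpl. specialize (Ha (S n)). lra. }
  destruct (ex_finite_lim_seq_incr _ M Hinc HM) as [L HL].
  split; [now exists L|].
  rewrite (is_series_unique a L HL).
  apply (is_lim_seq_le (sum_n a) (fun _ => M) L M HM HL (is_lim_seq_const M)).
Qed.

Lemma sum_n_le_Series (a : nat -> R) (N : nat) :
  (forall n, 0 <= a n) -> ex_series a -> sum_n a N <= Series a.
Proof.
  intros Ha [L HL]. rewrite (is_series_unique a L HL).
  apply (is_lim_seq_incr_compare (sum_n a) L HL).
  intros n. rewrite sum_Sn. unfold plus; simpl. specialize (Ha (S n)). lra.
Qed.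

Lemma term_le_Series (a : nat -> R) (n : nat) :
  (forall n, 0 <= a n) -> ex_series a -> a n <= Series a.
Proof.
  intros Ha Hex. eapply Rle_trans; [|apply (sum_n_le_Series a n Ha Hex)].
  destruct n as [|n]; [rewrite sum_O; lra|].
  rewrite sum_Sn. unfold plus; simpl.
  enough (0 <= sum_n a n) by lra.
  clear Hex. induction n as [|n IH]; [rewrite sum_O; apply Ha|].
  rewrite sum_Sn. unfold plus; simpl. specialize (Ha (S n)). lra.
Qed.

Lemma Series_nonneg (a : nat -> R) :
  (forall n, 0 <= a n) -> ex_series a -> 0 <= Series a.
Proof.
  intros Ha Hex. eapply Rle_trans; [apply (Ha O)|now apply term_le_Series].
Qed.

Lemma Series_sum_n (u : nat -> nat -> R) (M : nat) :
  (forall m, ex_series (fun n => u n m)) ->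
  ex_series (fun n => sum_n (u n) M) /\
  Series (fun n => sum_n (u n) M) = sum_n (fun m => Series (fun n => u n m)) M.
Proof.
  intros H. induction M as [|M [IH1 IH2]].
  - split.
    + apply (ex_series_ext (fun n => u n O)); [|apply H].
      intros n. now rewrite sum_O.
    + rewrite sum_O. apply Series_ext. intros n. now rewrite sum_O.
  - assert (E : forall n, sum_n (u n) M + u n (S M) = sum_n (u n) (S M)).
    { intros n. now rewrite sum_Sn. }
    split.
    + apply (ex_series_ext _ _ E), (ex_series_plus (fun n => sum_n (u n) M)
        (fun n => u n (S M))); easy.
    + rewrite sum_Sn, <- IH2, <- (Series_ext _ _ E).
      now apply Series_plus.
Qed.

(** A partial sum of column sums is the series of the partial row sums, hence at most the sum of the
    full row sums. Equality then follows by applying this to u and to its transpose. *)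
Lemma Tonelli_le (u : nat -> nat -> R) :
  (forall n m, 0 <= u n m) -> (forall n, ex_series (u n)) ->
  ex_series (fun n => Series (u n)) ->
  (forall m, ex_series (fun n => u n m)) /\
  ex_series (fun m => Series (fun n => u n m)) /\
  Series (fun m => Series (fun n => u n m)) <= Series (fun n => Series (u n)).
Proof.
  intros Hu Hrow Hsum.
  assert (Hcol : forall m, ex_series (fun n => u n m)).
  { intros m. apply (ex_series_le_R _ (fun n => Series (u n))); [|easy].
    intros n. rewrite Rabs_pos_eq by apply Hu. now apply (term_le_Series (u n)). }
  split; [easy|].
  apply ex_series_nonneg_bounded.
  - intros m. now apply Series_nonneg.
  - intros M. destruct (Series_sum_n u M Hcol) as [H1 <-].
    apply Series_le; [|easy]. intros n. split.
    + induction M as [|M IH] in |- *; [rewrite sum_O; apply Hu|].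
      rewrite sum_Sn. unfold plus; simpl. specialize (Hu n (S M)). lra.
    + now apply sum_n_le_Series.
Qed.

Lemma Tonelli (u : nat -> nat -> R) :
  (forall n m, 0 <= u n m) -> (forall n, ex_series (u n)) ->
  ex_series (fun n => Series (u n)) ->
  Series (fun m => Series (fun n => u n m)) = Series (fun n => Series (u n)).
Proof.
  intros Hu Hrow Hsum.
  destruct (Tonelli_le u Hu Hrow Hsum) as (H1 & H2 & H3).
  apply Rle_antisym; [easy|].
  apply (Tonelli_le (fun m n => u n m)); easy.
Qed.

(** Both U and U + v are nonnegative, so Tonelli applies to each; the claim for v is the
    difference. *)
Lemma Fubini_dominated (v U : nat -> nat -> R) :
  (forall n m, Rabs (v n m) <= U n m) -> (forall n, ex_series (U n)) ->
  ex_series (fun n => Series (U n)) ->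
  Series (fun m => Series (fun n => v n m)) = Series (fun n => Series (v n)).
Proof.
  intros Hv Hrow Hsum.
  assert (HU : forall n m, 0 <= U n m).
  { intros n m. eapply Rle_trans; [apply Rabs_pos|apply Hv]. }
  destruct (Tonelli_le U HU Hrow Hsum) as (Hcol & Hcsum & _).
  assert (HV : forall n m, 0 <= U n m + v n m).
  { intros n m. specialize (Hv n m). apply Rabs_le_between in Hv. lra. }
  assert (vrow : forall n, ex_series (v n)).
  { intros n. now apply (ex_series_le_R _ (U n)). }
  assert (vcol : forall m, ex_series (fun n => v n m)).
  { intros m. apply (ex_series_le_R _ (fun n => U n m)); [|easy]. intros n. apply Hv. }
  assert (vsum : ex_series (fun n => Series (v n))).
  { apply (ex_series_le_R _ (fun n => Series (U n))); [|easy]. intros n.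
    assert (A : ex_series (fun m => Rabs (v n m))).
    { apply (ex_series_le_R _ (U n)); [|easy]. intros m.
      now rewrite Rabs_Rabsolu. }
    eapply Rle_trans; [apply Series_Rabs, A|].
    apply Series_le; [|easy]. intros m. split; [apply Rabs_pos|apply Hv]. }
  assert (T := Tonelli (fun n m => U n m + v n m) HV).
  assert (E : forall n, Series (fun m => U n m + v n m) = Series (U n) + Series (v n)).
  { intros n. now apply Series_plus. }
  specialize (T (fun n => ex_series_plus (U n) (v n) (Hrow n) (vrow n))).
  assert (Hs : ex_series (fun n => Series (U n) + Series (v n))).
  { apply (ex_series_plus (fun n => Series (U n)) (fun n => Series (v n))); easy. }
  specialize (T (ex_series_ext _ _ (fun n => eq_sym (E n)) Hs)).
  cbv beta in T. rewrite (Series_ext _ _ E) in T.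
  rewrite (Series_plus _ _ Hsum vsum) in T.
  assert (E' : forall m, Series (fun n => U n m + v n m)
    = Series (fun n => U n m) + Series (fun n => v n m)).
  { intros n. now apply Series_plus. }
  assert (Hcs : ex_series (fun m => Series (fun n => U n m + v n m))).
  { apply (Tonelli_le (fun n m => U n m + v n m) HV
      (fun n => ex_series_plus (U n) (v n) (Hrow n) (vrow n))).
    exact (ex_series_ext _ _ (fun n => eq_sym (E n)) Hs). }
  assert (vcs : ex_series (fun m => Series (fun n => v n m))).
  { apply (ex_series_ext (fun m => Series (fun n => U n m + v n m)
                                   - Series (fun n => U n m))).
    - intros m. rewrite E'. exact (Rplus_minus_l _ _).
    - now apply (ex_series_minus (fun m => Series (fun n => U n m + v n m))
        (fun m => Series (fun n => U n m))). }
  rewrite (Series_ext _ _ E'), (Series_plus _ _ Hcsum vcs) in T.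
  rewrite (Tonelli U HU Hrow Hsum) in T. lra.
Qed.

(** * Complex series under absolute convergence *)

Definition summable (u : nat -> C) : Prop := ex_series (fun n => Cmod (u n)).

Lemma im_le_Cmod (c : C) : Rabs (Im c) <= Cmod c.
Proof. eapply Rle_trans; [|apply Rmax_Cmod]. apply Rmax_r. Qed.

Lemma summable_le (u : nat -> C) (b : nat -> R) :
  (forall n, Cmod (u n) <= b n) -> ex_series b -> summable u.
Proof.
  intros H. apply (ex_series_le_R (fun n => Cmod (u n))). intros n.
  rewrite Rabs_pos_eq; [easy|apply Cmod_ge_0].
Qed.

Lemma summable_ext (u v : nat -> C) :
  (forall n, u n = v n) -> summable u -> summable v.
Proof. intros H. apply ex_series_ext. intros n. now rewrite H. Qed.

Lemma summable_Rabs_Re (u : nat -> C) :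
  summable u -> ex_series (fun n => Rabs (Re (u n))).
Proof.
  apply (ex_series_le_R (fun n => Rabs (Re (u n)))). intros n.
  rewrite Rabs_Rabsolu. apply re_le_Cmod.
Qed.

Lemma summable_Rabs_Im (u : nat -> C) :
  summable u -> ex_series (fun n => Rabs (Im (u n))).
Proof.
  apply (ex_series_le_R (fun n => Rabs (Im (u n)))). intros n.
  rewrite Rabs_Rabsolu. apply im_le_Cmod.
Qed.

Lemma summable_Re (u : nat -> C) : summable u -> ex_series (fun n => Re (u n)).
Proof. intros H. now apply ex_series_Rabs, summable_Rabs_Re. Qed.

Lemma summable_Im (u : nat -> C) : summable u -> ex_series (fun n => Im (u n)).
Proof. intros H. now apply ex_series_Rabs, summable_Rabs_Im. Qed.

Lemma C_eq (z w : C) : Re z = Re w -> Im z = Im w -> z = w.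
Proof. destruct z, w; simpl; intros; subst; easy. Qed.

Lemma Re_CSeries (u : nat -> C) : Re (CSeries u) = Series (fun n => Re (u n)).
Proof. reflexivity. Qed.

Lemma Im_CSeries (u : nat -> C) : Im (CSeries u) = Series (fun n => Im (u n)).
Proof. reflexivity. Qed.

Lemma CSeries_ext (u v : nat -> C) :
  (forall n, u n = v n) -> CSeries u = CSeries v.
Proof.
  intros H. unfold CSeries. f_equal; apply Series_ext; intros n; now rewrite H.
Qed.

Lemma summable_plus (u v : nat -> C) :
  summable u -> summable v -> summable (fun n => u n + v n)%C.
Proof.
  intros Hu Hv. apply (summable_le _ (fun n => Cmod (u n) + Cmod (v n))).
  - intros n. apply Cmod_triangle.
  - apply (ex_series_plus (fun n => Cmod (u n)) (fun n => Cmod (v n))); easy.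
Qed.

Lemma CSeries_plus (u v : nat -> C) :
  summable u -> summable v ->
  CSeries (fun n => u n + v n)%C = (CSeries u + CSeries v)%C.
Proof.
  intros Hu Hv. apply C_eq; rewrite ?Re_CSeries, ?Im_CSeries.
  - apply Series_plus; now apply summable_Re.
  - apply Series_plus; now apply summable_Im.
Qed.

Lemma summable_scal (c : C) (u : nat -> C) :
  summable u -> summable (fun n => c * u n)%C.
Proof.
  intros Hu. apply (summable_le _ (fun n => Cmod c * Cmod (u n))).
  - intros n. rewrite Cmod_mult. lra.
  - apply (ex_series_scal_l (Cmod c) (fun n => Cmod (u n))). easy.
Qed.

Lemma CSeries_scal (c : C) (u : nat -> C) :
  summable u -> CSeries (fun n => c * u n)%C = (c * CSeries u)%C.
Proof.
  intros Hu. pose proof (summable_Re u Hu) as HR. pose proof (summable_Im u Hu) as HI.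
  apply C_eq; rewrite ?Re_CSeries, ?Im_CSeries; simpl.
  - rewrite <- !Series_scal_l. apply Series_minus.
    + apply (ex_series_scal_l (Re c) (fun n => Re (u n))). easy.
    + apply (ex_series_scal_l (Im c) (fun n => Im (u n))). easy.
  - rewrite <- !Series_scal_l. apply Series_plus.
    + apply (ex_series_scal_l (Re c) (fun n => Im (u n))). easy.
    + apply (ex_series_scal_l (Im c) (fun n => Re (u n))). easy.
Qed.

Lemma summable_incr_1 (u : nat -> C) : summable u <-> summable (fun n => u (S n)).
Proof. apply (ex_series_incr_1 (fun n => Cmod (u n))). Qed.

Lemma CSeries_incr_1 (u : nat -> C) :
  summable u -> CSeries u = (u O + CSeries (fun n => u (S n)))%C.
Proof.
  intros Hu. apply C_eq; simpl.
  - now apply (Series_incr_1 (fun n => Re (u n))), summable_Re.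
  - now apply (Series_incr_1 (fun n => Im (u n))), summable_Im.
Qed.

(** Rotating by the conjugate of the sum L reduces to real series: |L|^2 is the sum of the Re (conj
    L * u n), each at most |L| |u n|. Then |L| is cancelled. *)
Lemma Cmod_CSeries_le (u : nat -> C) :
  summable u -> Cmod (CSeries u) <= Series (fun n => Cmod (u n)).
Proof.
  intros Hu. set (L := CSeries u). set (M := Series _).
  destruct (Req_dec (Cmod L) 0) as [e|e].
  { rewrite e. apply Series_nonneg; [intros; apply Cmod_ge_0|easy]. }
  assert (HL : 0 < Cmod L) by (pose proof (Cmod_ge_0 L); lra).
  apply Rmult_le_reg_l with (Cmod L); [easy|].
  replace (Cmod L * Cmod L) with (Re (Cconj L * L)%C).
  2:{ pose proof (Cmod2_alt L) as E. simpl in E |- *. rewrite !Rmult_1_r in E. rewrite E.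
      ring. }
  pose proof (summable_scal (Cconj L) u Hu) as Hs.
  unfold L at 2. rewrite <- CSeries_scal, Re_CSeries by easy.
  eapply Rle_trans; [apply Rle_abs|].
  eapply Rle_trans; [apply Series_Rabs; now apply summable_Rabs_Re|].
  unfold M. rewrite <- Series_scal_l.
  apply Series_le.
  - intros n. split; [apply Rabs_pos|].
    rewrite <- (Cmod_conj L), <- Cmod_mult. apply re_le_Cmod.
  - apply (ex_series_scal_l (Cmod L) (fun n => Cmod (u n))). easy.
Qed.

Lemma CFubini (u : nat -> nat -> C) :
  (forall n, summable (u n)) ->
  ex_series (fun n => Series (fun m => Cmod (u n m))) ->
  (forall m, summable (fun n => u n m)) /\
  summable (fun m => CSeries (fun n => u n m)) /\
  CSeries (fun m => CSeries (fun n => u n m)) = CSeries (fun n => CSeries (u n)).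
Proof.
  intros Hrow Hsum.
  destruct (Tonelli_le (fun n m => Cmod (u n m))) as (H1 & H2 & _); auto.
  { intros; apply Cmod_ge_0. }
  split; [exact H1|]. split.
  - apply (summable_le _ (fun m => Series (fun n => Cmod (u n m)))); [|easy].
    intros m. apply Cmod_CSeries_le, H1.
  - apply C_eq; rewrite ?Re_CSeries, ?Im_CSeries.
    + apply (Fubini_dominated (fun n m => Re (u n m)) (fun n m => Cmod (u n m))); auto.
      intros; apply re_le_Cmod.
    + apply (Fubini_dominated (fun n m => Im (u n m)) (fun n m => Cmod (u n m))); auto.
      intros; apply im_le_Cmod.
Qed.

Lemma ex_series_finite (a : nat -> R) (N : nat) :
  (forall n, (N <= n)%nat -> a n = 0) -> ex_series a.
Proof.
  revert a; induction N as [|N IH]; intros a H.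
  - apply (ex_series_ext (fun n => 0 * (/ 2) ^ n)).
    + intros n. rewrite H by lia. exact (Rmult_0_l _).
    + apply (ex_series_scal_l 0 (fun n => (/ 2) ^ n)), ex_series_geom.
      rewrite Rabs_pos_eq; lra.
  - apply ex_series_incr_1, IH. intros n Hn. apply H. lia.
Qed.

Lemma summable_finite (u : nat -> C) (N : nat) :
  (forall n, (N <= n)%nat -> u n = RtoC 0) -> summable u.
Proof.
  intros H. apply (ex_series_finite _ N). intros n Hn. rewrite H by easy.
  apply Cmod_0.
Qed.

Lemma CSeries_finite (u : nat -> C) (N : nat) :
  (forall n, (N <= n)%nat -> u n = RtoC 0) -> CSeries u = Csum u N.
Proof.
  revert u; induction N as [|N IH]; intros u H.
  - simpl. apply C_eq; simpl; rewrite (Series_ext _ (fun n => 0 * 0));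
      try (rewrite Series_scal_l; ring); intros n; rewrite H by lia; simpl; ring.
  - rewrite CSeries_incr_1, Csum_S_l by (now apply (summable_finite _ (S N))).
    f_equal. apply IH. intros n Hn. apply H. lia.
Qed.

(* Cauchy product, as the double series with entries a_n b_(k-n) for n <= k. *)
Lemma CSeries_conv (a b : nat -> C) :
  summable a -> summable b ->
  summable (conv a b) /\ CSeries (conv a b) = (CSeries a * CSeries b)%C /\
  Series (fun n => Cmod (conv a b n))
    <= Series (fun n => Cmod (a n)) * Series (fun n => Cmod (b n)).
Proof.
  intros Ha Hb.
  set (u := fun n k => if Nat.leb n k then (a n * b (k - n)%nat)%C else RtoC 0).
  assert (Hshift : forall n, summable (u n) /\ CSeries (u n) = (a n * CSeries b)%C
    /\ Series (fun k => Cmod (u n k)) = Cmod (a n) * Series (fun k => Cmod (b k))).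
  (* Row n is b scaled by [a n] and preceded by n zeros; the induction removes one zero at a time,
     which changes neither the sum nor the sum of moduli. *)
  { assert (G : forall n (c : C) (v : nat -> C), summable v ->
      let w := fun k => if Nat.leb n k then (c * v (k - n)%nat)%C else RtoC 0 in
      summable w /\ CSeries w = (c * CSeries v)%C
      /\ Series (fun k => Cmod (w k)) = Cmod c * Series (fun k => Cmod (v k))).
    { intros n c v Hv. induction n as [|n IH]; intros w.
      - assert (E : forall k, (c * v k)%C = w k).
        { intros k. unfold w. simpl. now rewrite Nat.sub_0_r. }
        split; [|split].
        + apply (summable_ext _ _ E). now apply summable_scal.
        + rewrite <- (CSeries_ext _ _ E). now apply CSeries_scal.
        + rewrite <- Series_scal_l. apply Series_ext. intros k.
          now rewrite <- E, Cmod_mult.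
      - destruct IH as (I1 & I2 & I3).
        assert (Hw : summable w) by (apply summable_incr_1; exact I1).
        split; [easy|]. split.
        + rewrite CSeries_incr_1, <- I2 by easy. unfold w at 1. simpl Nat.leb.
          rewrite Cplus_0_l. easy.
        + rewrite <- I3, (Series_incr_1 (fun k => Cmod (w k)) Hw).
          replace (w O) with (RtoC 0) by easy.
          rewrite Cmod_0, Rplus_0_l. easy. }
    intros n. apply (G n (a n) b Hb). }
  assert (Hcol : forall k, CSeries (fun n => u n k) = conv a b k).
  { intros k. unfold conv. rewrite (CSeries_finite _ (S k)).
    - apply Csum_ext. intros i Hi. unfold u.
      now rewrite (proj2 (Nat.leb_le i k)) by lia.
    - intros n Hn. unfold u. now rewrite (proj2 (Nat.leb_gt n k)) by lia. }
  assert (Hs : ex_series (fun n => Series (fun m => Cmod (u n m)))).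
  { apply (ex_series_ext (fun n => Cmod (a n) * Series (fun k => Cmod (b k)))).
    - intros n. symmetry. apply Hshift.
    - apply (ex_series_scal_r _ (fun n => Cmod (a n))). easy. }
  destruct (CFubini u (fun n => proj1 (Hshift n)) Hs) as (F1 & F2 & F3).
  split; [exact (summable_ext _ _ Hcol F2)|]. split.
  - rewrite <- (CSeries_ext _ _ Hcol), F3.
    rewrite (CSeries_ext _ (fun n => CSeries b * a n)%C).
    + rewrite CSeries_scal by easy. ring.
    + intros n. rewrite (proj1 (proj2 (Hshift n))). ring.
  - rewrite <- Series_scal_r.
    rewrite (Series_ext (fun n => _ * _) _ (fun n => eq_sym (proj2 (proj2 (Hshift n))))).
    destruct (Tonelli_le (fun n m => Cmod (u n m))) as (T1 & T2 & T3).
    + intros; apply Cmod_ge_0.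
    + intros n; apply Hshift.
    + exact Hs.
    + eapply Rle_trans; [|exact T3]. apply Series_le; [|easy].
      intros k. split; [apply Cmod_ge_0|]. rewrite <- Hcol.
      apply Cmod_CSeries_le, F1.
Qed.

(** * Analytic functions of a real variable *)

Lemma conv_geom (a b : nat -> C) (s : C) (n : nat) :
  conv (fun n => a n * s ^ n)%C (fun n => b n * s ^ n)%C n = (conv a b n * s ^ n)%C.
Proof.
  unfold conv. rewrite Cmult_comm, <- Csum_scal. apply Csum_ext.
  intros i Hi. replace (s ^ n)%C with (s ^ i * s ^ (n - i))%C; [ring|].
  rewrite <- Cpow_add_r. f_equal. lia.
Qed.

Fixpoint conv_pow (e : nat -> C) (n : nat) : nat -> C :=
  match n with
  | O => fun m => match m with O => RtoC 1 | S _ => RtoC 0 end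
  | S n => conv e (conv_pow e n)
  end.

(** The sum of moduli is submultiplicative for the Cauchy product; the resulting bound on powers is
    what makes composition absolutely convergent. *)
Lemma CSeries_conv_pow (e : nat -> C) (n : nat) :
  summable e ->
  summable (conv_pow e n) /\ CSeries (conv_pow e n) = (CSeries e ^ n)%C /\
  Series (fun m => Cmod (conv_pow e n m)) <= Series (fun m => Cmod (e m)) ^ n.
Proof.
  intros He. induction n as [|n (I1 & I2 & I3)].
  - assert (Hf : forall m, (1 <= m)%nat -> conv_pow e 0 m = RtoC 0)
      by (intros [|m] Hm; [lia|easy]).
    assert (Hs : summable (conv_pow e 0)) by exact (summable_finite _ 1 Hf).
    split; [easy|]. split.
    + rewrite (CSeries_finite _ 1 Hf). simpl. ring.
    + rewrite (Series_incr_1 _ Hs). simpl.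
      rewrite (Series_ext _ (fun _ => 0 * 0)), Series_scal_l, Cmod_1; [lra|].
      intros m. rewrite Cmod_0. ring.
  - destruct (CSeries_conv e (conv_pow e n) He I1) as (J1 & J2 & J3).
    split; [easy|]. split.
    + simpl. now rewrite J2, I2.
    + eapply Rle_trans; [exact J3|]. simpl. apply Rmult_le_compat_l; [|easy].
      apply Series_nonneg; [intros; apply Cmod_ge_0|easy].
Qed.

Lemma conv_pow_geom (e : nat -> C) (s : C) (n m : nat) :
  conv_pow (fun m => e m * s ^ m)%C n m = (conv_pow e n m * s ^ m)%C.
Proof.
  revert m; induction n as [|n IH]; intros m.
  - destruct m; simpl; ring.
  - simpl. rewrite <- conv_geom. unfold conv. apply Csum_ext. intros i Hi.
    now rewrite IH.
Qed.

(** The double series b_n (e^n)_m has row n dominated by |b_n| rho^n, so it may be summed by the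
    power of the inner variable first. *)
Lemma CSeries_compose (b e : nat -> C) (rho : R) :
  summable e -> Series (fun m => Cmod (e m)) <= rho ->
  ex_series (fun n => Cmod (b n) * rho ^ n) ->
  let d := fun m => CSeries (fun n => b n * conv_pow e n m)%C in
  summable d /\ CSeries d = CSeries (fun n => b n * CSeries e ^ n)%C.
Proof.
  intros He Hrho Hb d.
  assert (N0 : 0 <= Series (fun m => Cmod (e m))).
  { apply Series_nonneg; [intros; apply Cmod_ge_0|easy]. }
  destruct (CFubini (fun n m => b n * conv_pow e n m)%C) as (F1 & F2 & F3).
  - intros n. now apply summable_scal, CSeries_conv_pow.
  - apply (ex_series_le_R _ (fun n => Cmod (b n) * rho ^ n)); [|easy].
    intros n. destruct (CSeries_conv_pow e n He) as (J1 & J2 & J3).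
    rewrite (Series_ext _ (fun m => Cmod (b n) * Cmod (conv_pow e n m)))
      by (intros; apply Cmod_mult).
    rewrite Series_scal_l, Rabs_pos_eq.
    + apply Rmult_le_compat_l; [apply Cmod_ge_0|].
      eapply Rle_trans; [exact J3|]. now apply pow_incr.
    + apply Rmult_le_pos; [apply Cmod_ge_0|].
      apply Series_nonneg; [intros; apply Cmod_ge_0|easy].
  - split; [exact F2|]. unfold d. rewrite F3. apply CSeries_ext. intros n.
    destruct (CSeries_conv_pow e n He) as (J1 & J2 & J3).
    rewrite CSeries_scal by easy. now rewrite J2.
Qed.

(** Absolute convergence is required at the radius rho itself, so the expansion is valid on the
    closed interval and shrinking the radius needs no strict inequalities. *)
Definition analytic_at (F : R -> C) (t0 : R) : Prop :=
  exists (e : nat -> C) (rho : R), 0 < rho /\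
    summable (fun m => e m * RtoC rho ^ m)%C /\
    forall s, Rabs s <= rho -> F (t0 + s) = CSeries (fun m => e m * RtoC s ^ m)%C.

Lemma summable_disc (e : nat -> C) (rho : R) (s : C) :
  Cmod s <= rho -> summable (fun m => e m * RtoC rho ^ m)%C ->
  summable (fun m => e m * s ^ m)%C.
Proof.
  intros Hs. apply summable_le. intros n.
  rewrite !Cmod_mult, !Cmod_pow, Cmod_R.
  apply Rmult_le_compat_l; [apply Cmod_ge_0|].
  apply pow_incr. split; [apply Cmod_ge_0|].
  eapply Rle_trans; [exact Hs|apply Rle_abs].
Qed.

Lemma summable_shift (e : nat -> C) (rho : R) : 0 < rho ->
  summable (fun m => e m * RtoC rho ^ m)%C ->
  summable (fun m => e (S m) * RtoC rho ^ m)%C.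
Proof.
  intros Hr He. apply summable_incr_1 in He.
  apply (summable_ext (fun m => RtoC (/ rho) * (e (S m) * RtoC rho ^ (S m)))%C).
  - intros m. simpl. rewrite RtoC_inv by lra. field.
    intros K. apply RtoC_inj in K. lra.
  - now apply summable_scal.
Qed.

Lemma CSeries_geom_incr (e : nat -> C) (s : C) :
  summable (fun m => e m * s ^ m)%C -> summable (fun m => e (S m) * s ^ m)%C ->
  CSeries (fun m => e m * s ^ m)%C
  = (e O + s * CSeries (fun m => e (S m) * s ^ m))%C.
Proof.
  intros H H1. rewrite (CSeries_incr_1 _ H), <- CSeries_scal by easy.
  f_equal; [simpl; ring|]. apply CSeries_ext. intros m. simpl. ring.
Qed.

Lemma analytic_at_ext (F G : R -> C) (t0 : R) :
  (forall t, F t = G t) -> analytic_at F t0 -> analytic_at G t0.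
Proof.
  intros H (e & rho & Hr & He & E). exists e, rho. repeat split; auto.
  intros s Hs. rewrite <- H. auto.
Qed.

Lemma analytic_at_affine (c d : C) (t0 : R) :
  analytic_at (fun t => c + d * RtoC t)%C t0.
Proof.
  set (e := fun m => match m with O => (c + d * RtoC t0)%C | 1%nat => d | _ => RtoC 0 end).
  exists e, 1.
  assert (H : forall s n, (2 <= n)%nat -> (e n * RtoC s ^ n)%C = RtoC 0).
  { intros s [|[|n]] Hn; [lia|lia|]. unfold e. ring. }
  split; [lra|]. split; [exact (summable_finite _ 2 (H 1))|].
  intros s _. rewrite (CSeries_finite _ 2 (H s)). simpl. rewrite RtoC_plus. ring.
Qed.

Lemma analytic_at_const (c : C) (t0 : R) : analytic_at (fun _ => c) t0.
Proof.
  apply (analytic_at_ext (fun t => c + RtoC 0 * RtoC t)%C); [intros; ring|].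
  apply analytic_at_affine.
Qed.

Lemma analytic_at_linear (d : C) (t0 : R) : analytic_at (fun t => RtoC t * d)%C t0.
Proof.
  apply (analytic_at_ext (fun t => RtoC 0 + d * RtoC t)%C); [intros; ring|].
  apply analytic_at_affine.
Qed.

Lemma analytic_at_common (F G : R -> C) (t0 : R) :
  analytic_at F t0 -> analytic_at G t0 ->
  exists (e e' : nat -> C) (rho : R), 0 < rho /\
    summable (fun m => e m * RtoC rho ^ m)%C /\
    summable (fun m => e' m * RtoC rho ^ m)%C /\
    forall s, Rabs s <= rho ->
      F (t0 + s) = CSeries (fun m => e m * RtoC s ^ m)%C /\
      G (t0 + s) = CSeries (fun m => e' m * RtoC s ^ m)%C.
Proof.
  intros (e & r1 & Hr1 & He & E1) (e' & r2 & Hr2 & He' & E2).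
  exists e, e', (Rmin r1 r2).
  assert (Hm : 0 < Rmin r1 r2) by now apply Rmin_pos.
  assert (A : Cmod (RtoC (Rmin r1 r2)) = Rmin r1 r2) by (rewrite Cmod_R, Rabs_pos_eq; lra).
  pose proof (Rmin_l r1 r2). pose proof (Rmin_r r1 r2).
  split; [easy|]. split; [apply (summable_disc _ r1); [lra|easy]|].
  split; [apply (summable_disc _ r2); [lra|easy]|].
  intros s Hs. split; [apply E1|apply E2]; lra.
Qed.

Lemma analytic_at_plus (F G : R -> C) (t0 : R) :
  analytic_at F t0 -> analytic_at G t0 -> analytic_at (fun t => F t + G t)%C t0.
Proof.
  intros HF HG.
  destruct (analytic_at_common F G t0 HF HG) as (e & e' & r & Hr & He & He' & E).
  exists (fun m => e m + e' m)%C, r. split; [easy|]. split.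
  - apply (summable_ext (fun m => e m * RtoC r ^ m + e' m * RtoC r ^ m)%C);
      [intros; ring|now apply summable_plus].
  - intros s Hs. destruct (E s Hs) as [-> ->]. rewrite <- CSeries_plus.
    + apply CSeries_ext. intros; ring.
    + apply (summable_disc _ r); [now rewrite Cmod_R|easy].
    + apply (summable_disc _ r); [now rewrite Cmod_R|easy].
Qed.

Lemma analytic_at_mult (F G : R -> C) (t0 : R) :
  analytic_at F t0 -> analytic_at G t0 -> analytic_at (fun t => F t * G t)%C t0.
Proof.
  intros HF HG.
  destruct (analytic_at_common F G t0 HF HG) as (e & e' & r & Hr & He & He' & E).
  exists (conv e e'), r. split; [easy|]. split.
  - apply (summable_ext _ _ (conv_geom e e' (RtoC r))). now apply CSeries_conv.
  - intros s Hs. destruct (E s Hs) as [-> ->].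
    rewrite <- (CSeries_ext _ _ (conv_geom e e' (RtoC s))).
    symmetry. apply CSeries_conv; apply (summable_disc _ r); auto; now rewrite Cmod_R.
Qed.

Lemma analytic_at_pow (F : R -> C) (t0 : R) (n : nat) :
  analytic_at F t0 -> analytic_at (fun t => F t ^ n)%C t0.
Proof.
  intros HF. induction n as [|n IH]; [apply (analytic_at_const (RtoC 1))|].
  now apply (analytic_at_mult F).
Qed.

(** Since |F t0| < rho, the moduli of the expansion of F at t0 still sum to at most rho on a small
    interval, where the composition of series applies. *)
Lemma analytic_at_compose (b : nat -> C) (rho : R) (F : R -> C) (t0 : R) :
  ex_series (fun n => Cmod (b n) * rho ^ n) ->
  analytic_at F t0 -> Cmod (F t0) < rho ->
  analytic_at (fun t => CSeries (fun n => b n * F t ^ n)%C) t0.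
Proof.
  intros Hb (e & r & Hr & He & E) HF.
  set (N := Series (fun m => Cmod (e (S m) * RtoC r ^ m)%C)).
  pose proof (summable_shift e r Hr He) as He1.
  assert (HN : 0 <= N).
  { apply Series_nonneg; [intros; apply Cmod_ge_0|easy]. }
  assert (F0 : F t0 = e O).
  { pose proof (E 0) as E0. rewrite Rplus_0_r in E0. rewrite E0 by (rewrite Rabs_R0; lra).
    rewrite (CSeries_finite _ 1); [simpl; ring|].
    intros [|n] Hn; [lia|]. simpl. ring. }
  (* At radius r' the moduli sum to at most |F t0| + r' N, and this choice keeps that below rho. The
     summand 1 guards against N = 0. *)
  set (r' := Rmin r ((rho - Cmod (F t0)) / (N + 1))).
  assert (Hr' : 0 < r').
  { apply Rmin_pos; [easy|]. apply Rdiv_lt_0_compat; lra. }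
  assert (Hr'r : r' <= r) by apply Rmin_l.
  assert (HrN : r' * N <= rho - Cmod (F t0)).
  { apply Rle_trans with (r' * (N + 1)); [apply Rmult_le_compat_l; lra|].
    apply Rle_trans with ((rho - Cmod (F t0)) / (N + 1) * (N + 1)).
    - apply Rmult_le_compat_r; [lra|apply Rmin_r].
    - right. field. lra. }
  assert (Mod : forall s, Rabs s <= r' -> summable (fun m => e m * RtoC s ^ m)%C
     /\ Series (fun m => Cmod (e m * RtoC s ^ m)%C) <= rho).
  { intros s Hs.
    assert (S1 : summable (fun m => e m * RtoC s ^ m)%C)
      by (apply (summable_disc _ r); [rewrite Cmod_R; lra|easy]).
    split; [easy|]. rewrite (Series_incr_1 _ S1).
    apply Rle_trans with (Cmod (e O) + r' * N); [|rewrite <- F0; lra].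
    apply Rplus_le_compat.
    - simpl. rewrite Cmult_1_r. lra.
    - unfold N. rewrite <- Series_scal_l. apply Series_le.
      + intros m. split; [apply Cmod_ge_0|].
        rewrite !Cmod_mult, !Cmod_pow, !Cmod_R, (Rabs_pos_eq r) by lra. simpl.
        replace (Cmod (e (S m)) * (Rabs s * Rabs s ^ m))
          with (Rabs s * (Cmod (e (S m)) * Rabs s ^ m)) by ring.
        pose proof (Cmod_ge_0 (e (S m))). pose proof (Rabs_pos s).
        apply Rmult_le_compat; [easy| |easy|].
        * apply Rmult_le_pos; [easy|now apply pow_le].
        * apply Rmult_le_compat_l; [easy|]. apply pow_incr. lra.
      + apply (ex_series_scal_l r' (fun m => Cmod (e (S m) * RtoC r ^ m)%C)).
        exact He1. }
  exists (fun m => CSeries (fun n => b n * conv_pow e n m)%C), r'.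
  (* Composition is applied to the coefficients e_m s^m; K pulls s^m out of the coefficients of the
     composite. For s <> 0 this is division by s^m, while at s = 0 only the constant term
     survives. *)
  assert (K : forall s, Rabs s <= r' -> forall m,
    CSeries (fun n => b n * conv_pow (fun m => e m * RtoC s ^ m) n m)%C
    = (CSeries (fun n => b n * conv_pow e n m) * RtoC s ^ m)%C).
  { intros s Hs m. destruct (Req_dec s 0) as [->|s0].
    - destruct m as [|m].
      + simpl. rewrite Cmult_1_r. apply CSeries_ext. intros n.
        rewrite conv_pow_geom. simpl. ring.
      + rewrite (CSeries_finite _ 0); [simpl; ring|].
        intros n _. rewrite conv_pow_geom. simpl. ring.
    - destruct (Mod s Hs) as [M1 M2].
      assert (Hsm : summable (fun n => b n * conv_pow (fun m => e m * RtoC s ^ m) n m)%C).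
      { apply (summable_le _ (fun n => Cmod (b n) * rho ^ n)); [|easy].
        intros n. rewrite Cmod_mult. apply Rmult_le_compat_l; [apply Cmod_ge_0|].
        destruct (CSeries_conv_pow _ n M1) as (J1 & _ & J3).
        eapply Rle_trans; [|apply pow_incr; split; [|exact M2]].
        - eapply Rle_trans; [|exact J3].
          apply (term_le_Series (fun m0 => Cmod (conv_pow (fun m => e m * RtoC s ^ m)%C n m0)));
            [intros; apply Cmod_ge_0|easy].
        - apply Series_nonneg; [intros; apply Cmod_ge_0|easy]. }
      assert (s1 : (RtoC s ^ m)%C <> RtoC 0).
      { apply Cpow_nz. intros Q. apply RtoC_inj in Q. easy. }
      assert (Hx : forall n, (/ (RtoC s ^ m) * (b n * conv_pow (fun m => e m * RtoC s ^ m) n m))%C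
         = (b n * conv_pow e n m)%C).
      { intros n. rewrite conv_pow_geom. field. easy. }
      rewrite <- (CSeries_ext _ _ Hx), CSeries_scal by easy. field. easy. }
  split; [easy|]. split.
  - assert (Q : Rabs r' <= r') by (rewrite Rabs_pos_eq; lra).
    destruct (Mod r' Q) as [M1 M2].
    apply (summable_ext _ _ (K r' Q)).
    now apply (CSeries_compose b _ rho).
  - intros s Hs. destruct (Mod s Hs) as [M1 M2].
    rewrite <- (CSeries_ext _ _ (K s Hs)), E by lra. symmetry.
    now apply (CSeries_compose b _ rho).
Qed.

(** * Local behaviour and zeros of analytic functions *)

Lemma CSeries_lipschitz (e : nat -> C) (r : R) : 0 < r ->
  summable (fun m => e m * RtoC r ^ m)%C ->
  exists L, 0 <= L /\ forall s, Rabs s <= r ->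
    Cmod (CSeries (fun m => e m * RtoC s ^ m)%C - e O) <= L * Rabs s.
Proof.
  intros Hr He. pose proof (summable_shift e r Hr He) as He1.
  exists (Series (fun m => Cmod (e (S m) * RtoC r ^ m)%C)). split.
  - apply Series_nonneg; [intros; apply Cmod_ge_0|easy].
  - intros s Hs. rewrite CSeries_geom_incr.
    2,3: apply (summable_disc _ r); [rewrite Cmod_R; lra|easy].
    match goal with |- Cmod ?z <= _ =>
      replace z with (RtoC s * CSeries (fun m => e (S m) * RtoC s ^ m))%C by ring end.
    rewrite Cmod_mult, Cmod_R, Rmult_comm.
    apply Rmult_le_compat_r; [apply Rabs_pos|].
    eapply Rle_trans; [apply Cmod_CSeries_le|].
    + apply (summable_disc _ r); [rewrite Cmod_R; lra|easy].
    + apply Series_le; [|easy]. intros n. split; [apply Cmod_ge_0|].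
      rewrite !Cmod_mult, !Cmod_pow, !Cmod_R, (Rabs_pos_eq r) by lra.
      apply Rmult_le_compat_l; [apply Cmod_ge_0|]. apply pow_incr.
      split; [apply Rabs_pos|easy].
Qed.

Lemma analytic_at_lipschitz (F : R -> C) (t0 : R) :
  analytic_at F t0 ->
  exists r L, 0 < r /\ 0 <= L /\
    forall s, Rabs s <= r -> Cmod (F (t0 + s)%R - F t0) <= L * Rabs s.
Proof.
  intros (e & r & Hr & He & E).
  destruct (CSeries_lipschitz e r Hr He) as (L & HL & H).
  exists r, L. repeat split; auto. intros s Hs.
  replace (F t0) with (e O); [rewrite E by easy; auto|].
  replace t0 with (t0 + 0) by ring. rewrite E by (rewrite Rabs_R0; lra).
  rewrite (CSeries_finite _ 1); [simpl; ring|].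
  intros [|n] Hn; [lia|]. simpl. ring.
Qed.

Lemma analytic_at_neq_0 (F : R -> C) (t0 : R) :
  analytic_at F t0 -> F t0 <> RtoC 0 ->
  exists r, 0 < r /\ forall s, Rabs s <= r -> F (t0 + s) <> RtoC 0.
Proof.
  intros HF H0. destruct (analytic_at_lipschitz F t0 HF) as (r & L & Hr & HL & H).
  apply Cmod_gt_0 in H0.
  exists (Rmin r (Cmod (F t0) / (L + 1) / 2)). split.
  - apply Rmin_pos; [easy|]. repeat apply Rdiv_lt_0_compat; lra.
  - intros s Hs K.
    pose proof (Rmin_l r (Cmod (F t0) / (L + 1) / 2)).
    pose proof (Rmin_r r (Cmod (F t0) / (L + 1) / 2)).
    specialize (H s ltac:(lra)). rewrite K in H.
    replace (RtoC 0 - F t0)%C with (- F t0)%C in H by ring.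
    rewrite Cmod_opp in H.
    assert (L * Rabs s <= (L + 1) * (Cmod (F t0) / (L + 1) / 2)).
    { apply Rmult_le_compat; try lra. apply Rabs_pos. }
    replace ((L + 1) * (Cmod (F t0) / (L + 1) / 2)) with (Cmod (F t0) / 2) in *
      by (field; lra). lra.
Qed.

(** The constant term is the limit from the left, hence 0; dividing by s shifts the coefficients.
    Zeros on the left alone must suffice, because the identity theorem reaches the supremum of its
    zero interval from below. *)
Lemma CSeries_zero_left (m : nat) (e : nat -> C) (r r1 : R) :
  0 < r1 <= r -> summable (fun m => e m * RtoC r ^ m)%C ->
  (forall s, - r1 < s < 0 -> CSeries (fun m => e m * RtoC s ^ m)%C = RtoC 0) ->
  e m = RtoC 0.
Proof.
  intros Hr. revert e.
  assert (H0 : forall e, summable (fun m => e m * RtoC r ^ m)%C ->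
    (forall s, - r1 < s < 0 -> CSeries (fun m => e m * RtoC s ^ m)%C = RtoC 0) ->
    e O = RtoC 0).
  { intros e He HZ. destruct (CSeries_lipschitz e r ltac:(lra) He) as (L & HL & H).
    apply Cmod_eq_0. apply Rle_antisym; [|apply Cmod_ge_0].
    apply Rnot_lt_le. intros K.
    set (s := Rmin (r1 / 2) (Cmod (e O) / (L + 1) / 2)).
    assert (Hs0 : 0 < s).
    { apply Rmin_pos; [lra|]. repeat apply Rdiv_lt_0_compat; lra. }
    assert (Hs1 : s <= r1 / 2) by apply Rmin_l.
    assert (Hs2 : s <= Cmod (e O) / (L + 1) / 2) by apply Rmin_r.
    assert (A : Rabs (- s) = s) by (rewrite Rabs_Ropp, Rabs_pos_eq; lra).
    specialize (H (- s) ltac:(lra)). rewrite (HZ (- s) ltac:(lra)), A in H.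
    replace (RtoC 0 - e O)%C with (- e O)%C in H by ring. rewrite Cmod_opp in H.
    assert (L * s <= (L + 1) * (Cmod (e O) / (L + 1) / 2)).
    { apply Rmult_le_compat; lra. }
    replace ((L + 1) * (Cmod (e O) / (L + 1) / 2)) with (Cmod (e O) / 2) in *
      by (field; lra). lra. }
  induction m as [|m IH]; intros e He HZ; [now apply H0|].
  apply (IH (fun m => e (S m))).
  - apply summable_shift; [lra|easy].
  - intros s Hs. pose proof (HZ s Hs) as Z.
    rewrite CSeries_geom_incr in Z.
    2: apply (summable_disc _ r); [rewrite Cmod_R, Rabs_left; lra|easy].
    2: apply (summable_disc _ r); [rewrite Cmod_R, Rabs_left; lra|
         apply summable_shift; [lra|easy]].
    rewrite (H0 e He HZ), Cplus_0_l in Z.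
    set (w := CSeries _) in Z |- *.
    assert (s0 : RtoC s <> RtoC 0) by (intros Q; apply RtoC_inj in Q; lra).
    replace w with (/ RtoC s * (RtoC s * w))%C by (field; easy).
    rewrite Z. ring.
Qed.

Lemma analytic_identity (F : R -> C) (eps : R) :
  0 < eps -> (forall t, 0 < t < 1 -> analytic_at F t) ->
  (forall t, 0 < t < eps -> F t = RtoC 0) ->
  forall t, 0 < t < 1 -> F t = RtoC 0.
Proof.
  intros He HF H0 t1 Ht1. apply NNPP. intros HN.
  (* The cap t1 makes E bounded. At its supremum T the expansion of F vanishes on the left, hence on
     a whole neighbourhood of T. This would push E beyond T unless T = t1, and then F t1 = 0. *)
  set (E := fun t => t <= t1 /\ forall t', 0 < t' < t -> F t' = RtoC 0).
  assert (HE1 : bound E) by (exists t1; intros t Ht; apply Ht).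
  assert (HE2 : E (Rmin eps t1)).
  { split; [apply Rmin_r|]. intros t' Ht'. apply H0.
    pose proof (Rmin_l eps t1). lra. }
  destruct (completeness E HE1 (ex_intro _ _ HE2)) as [T [HT1 HT2]].
  assert (T0 : 0 < T).
  { apply Rlt_le_trans with (Rmin eps t1); [apply Rmin_pos; lra|now apply HT1]. }
  assert (TT : T <= t1) by (apply HT2; intros t Ht; apply Ht).
  assert (Z : forall t, 0 < t < T -> F t = RtoC 0).
  { intros t Ht. apply NNPP. intros K.
    enough (T <= t) by lra. apply HT2. intros t' [_ Ht'].
    apply Rnot_lt_le. intros Q. apply K, Ht'. lra. }
  destruct (HF T ltac:(lra)) as (e & r & Hr & Hs & EF).
  assert (e0 : forall m, e m = RtoC 0).
  { intros m. apply (CSeries_zero_left m e r (Rmin r T)); auto.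
    - split; [apply Rmin_pos; lra|apply Rmin_l].
    - intros s Hss. pose proof (Rmin_l r T). pose proof (Rmin_r r T).
      rewrite <- EF by (rewrite Rabs_left; lra). apply Z. lra. }
  assert (Z' : forall s, Rabs s <= r -> F (T + s) = RtoC 0).
  { intros s Hss. rewrite EF by easy. rewrite (CSeries_finite _ 0); [easy|].
    intros n _. rewrite e0. ring. }
  assert (HT3 : E (Rmin t1 (T + r))).
  { split; [apply Rmin_l|]. intros t' Ht'. pose proof (Rmin_r t1 (T + r)).
    destruct (Rlt_le_dec t' T) as [q|q]; [apply Z; lra|].
    replace t' with (T + (t' - T)) by ring. apply Z'. rewrite Rabs_pos_eq; lra. }
  apply HT1 in HT3. unfold Rmin in HT3. destruct (Rle_dec t1 (T + r)); [|lra].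
  apply HN. replace t1 with (T + (t1 - T)) by ring. apply Z'.
  rewrite Rabs_pos_eq; lra.
Qed.

(** * Gamma and generalized binomial coefficients *)

(** Convexity of exp: the tangent at x a, where a = ln (1 + y), lies below exp at a and at 0;
    averaging with weights x and 1 - x cancels the linear terms. *)
Lemma Rpower_Bernoulli (x y : R) :
  0 <= x <= 1 -> -1 < y -> Rpower (1 + y) x <= 1 + x * y.
Proof.
  intros Hx Hy. unfold Rpower. set (a := ln (1 + y)).
  assert (Ea : exp a = 1 + y) by (apply exp_ln; lra).
  pose proof (exp_pos (x * a)) as Hp.
  assert (H1 : exp (x * a) * (1 + (a - x * a)) <= exp a).
  { replace (exp a) with (exp (x * a) * exp (a - x * a))
      by (rewrite <- exp_plus; f_equal; ring).
    apply Rmult_le_compat_l; [lra|apply exp_ineq1_le]. }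
  assert (H2 : exp (x * a) * (1 + (- (x * a))) <= 1).
  { replace 1 with (exp (x * a) * exp (- (x * a))) at 2
      by (rewrite <- exp_plus, Rplus_opp_r; apply exp_0).
    apply Rmult_le_compat_l; [lra|apply exp_ineq1_le]. }
  replace (1 + x * y) with (x * exp a + (1 - x) * 1) by (rewrite Ea; ring).
  apply Rle_trans with (x * (exp (x * a) * (1 + (a - x * a)))
    + (1 - x) * (exp (x * a) * (1 + - (x * a)))); [right; ring|].
  apply Rplus_le_compat; apply Rmult_le_compat_l; lra.
Qed.

(** The sequence whose limit defines [Gamma]. It is studied at indices [S n], where the base of
    [Rpower] is positive. *)
Definition gauss (x : R) (N : nat) : R :=
  INR (fact N) * Rpower (INR N) x / prod_f_R0 (fun j => x + INR j) N.

Definition not_pole (x : R) : Prop := forall j : nat, x + INR j <> 0.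

Lemma prod_not_pole (x : R) (N : nat) :
  not_pole x -> prod_f_R0 (fun j => x + INR j) N <> 0.
Proof.
  intros H. induction N as [|N IH]; [apply (H O)|].
  apply Rmult_integral_contrapositive. split; [exact IH|apply (H (S N))].
Qed.

Lemma prod_shift (x : R) (N : nat) :
  x * prod_f_R0 (fun j => x + 1 + INR j) N
  = prod_f_R0 (fun j => x + INR j) N * (x + INR N + 1).
Proof.
  induction N as [|N IH]; [simpl; ring|].
  cbn [prod_f_R0]. rewrite <- Rmult_assoc, IH, S_INR. ring.
Qed.

Lemma gauss_S (x : R) (N : nat) : not_pole x ->
  gauss x (S (S N)) * (x + INR (S (S N))) * Rpower (INR (S N)) x
  = gauss x (S N) * INR (S (S N)) * Rpower (INR (S (S N))) x.
Proof.
  intros H. unfold gauss. cbn [prod_f_R0].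
  change (fact (S (S N))) with (S (S N) * fact (S N))%nat. rewrite mult_INR.
  pose proof (H (S N)). pose proof (H (S (S N))). pose proof (prod_not_pole x N H).
  field. auto.
Qed.

Lemma gauss_shift (x : R) (N : nat) : not_pole x ->
  gauss (x + 1) (S N) * (x + INR (S N) + 1) = x * INR (S N) * gauss x (S N).
Proof.
  intros H. unfold gauss.
  assert (H0 : x <> 0) by (specialize (H O); simpl in H; lra).
  assert (H1 : x + INR (S N) + 1 <> 0).
  { specialize (H (S (S N))). rewrite S_INR in H. lra. }
  pose proof (prod_not_pole x (S N) H) as Hp.
  pose proof (prod_shift x (S N)) as E.
  assert (Hp' : prod_f_R0 (fun j => x + 1 + INR j) (S N) <> 0).
  { intros K. rewrite K, Rmult_0_r in E. symmetry in E.
    apply Rmult_integral in E. destruct E; contradiction. }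
  assert (HN : 0 < INR (S N)) by (apply lt_0_INR; lia).
  rewrite Rpower_plus, Rpower_1 by easy.
  set (P := prod_f_R0 (fun j => x + 1 + INR j) (S N)) in *.
  set (Q := prod_f_R0 (fun j => x + INR j) (S N)) in *.
  replace (x + INR (S N) + 1) with (x * P / Q) by (rewrite E; field; easy).
  field. easy.
Qed.

Lemma gauss_pos (x : R) (N : nat) : 0 < x -> 0 < gauss x N.
Proof.
  intros Hx. apply Rdiv_lt_0_compat.
  - apply Rmult_lt_0_compat; [apply INR_fact_lt_0|apply exp_pos].
  - induction N as [|N IH]; simpl; [lra|].
    apply Rmult_lt_0_compat; [exact IH|].
    change (0 < x + INR (S N)). pose proof (pos_INR (S N)). lra.
Qed.

(** Bernoulli's inequality with y = -1/(n+2) makes the products increase, and with y = 1/(n+1) it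
    makes a majorant decrease. The limit is positive, being at least the first product. *)
Lemma gauss_cv_unit (x : R) : 0 < x <= 1 ->
  exists L, 0 < L /\ is_lim_seq (fun n => gauss x (S n)) L.
Proof.
  intros Hx.
  assert (np : not_pole x) by (intros j; pose proof (pos_INR j); lra).
  assert (Hg : forall n, 0 < gauss x (S n)) by (intros; apply gauss_pos; lra).
  assert (HI : forall n, 1 <= INR (S n)).
  { intros n. rewrite S_INR. pose proof (pos_INR n). lra. }
  assert (Hinc : forall n, gauss x (S n) <= gauss x (S (S n))).
  { intros n. pose proof (gauss_S x n np) as E.
    set (M := INR (S (S n))) in *. pose proof (HI n) as Hn. pose proof (HI (S n)) as Hm.
    fold M in Hm. assert (EM : INR (S n) = M - 1) by (unfold M; rewrite (S_INR (S n)); ring).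
    assert (B : Rpower (INR (S n)) x <= (1 - x / M) * Rpower M x).
    { replace (INR (S n)) with ((1 + - / M) * M) by (rewrite EM; field; lra).
      assert (/ M < 1).
      { rewrite <- Rinv_1. apply Rinv_lt_contravar; lra. }
      rewrite <- Rpower_mult_distr by lra.
      apply Rmult_le_compat_r; [left; apply exp_pos|].
      replace (1 - x / M) with (1 + x * - / M) by (field; lra).
      apply Rpower_Bernoulli; lra. }
    pose proof (exp_pos (x * ln (INR (S n)))) as P1.
    change (0 < Rpower (INR (S n)) x) in P1.
    pose proof (exp_pos (x * ln M)) as P2. change (0 < Rpower M x) in P2.
    set (u := Rpower (INR (S n)) x) in *. set (v := Rpower M x) in *.
    assert (K : (x + M) * u <= M * v).
    { apply Rle_trans with ((x + M) * ((1 - x / M) * v)).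
      - apply Rmult_le_compat_l; lra.
      - replace ((x + M) * ((1 - x / M) * v)) with (M * v - x * x * / M * v)
          by (field; lra).
        assert (0 <= x * x * / M * v); [|lra].
        repeat apply Rmult_le_pos; try lra. left; apply Rinv_0_lt_compat; lra. }
    apply Rmult_le_reg_r with ((x + M) * u); [apply Rmult_lt_0_compat; lra|].
    rewrite <- (Rmult_assoc (gauss x (S (S n)))), E, Rmult_assoc.
    apply Rmult_le_compat_l; [left; apply Hg|easy]. }
  (* The Gauss products increase and stay below the decreasing sequence H. *)
  set (H := fun n => gauss x (S n) * (x + INR (S n)) / INR (S n)).
  assert (Hdec : forall n, H (S n) <= H n).
  { intros n. unfold H. pose proof (gauss_S x n np) as E.
    pose proof (HI n) as Hn. pose proof (HI (S n)) as Hm.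
    pose proof (exp_pos (x * ln (INR (S n)))) as P1.
    change (0 < Rpower (INR (S n)) x) in P1.
    assert (EM : INR (S (S n)) = INR (S n) + 1) by now rewrite (S_INR (S n)).
    set (M := INR (S (S n))) in *. set (N := INR (S n)) in *.
    assert (B : Rpower M x <= (1 + x / N) * Rpower N x).
    { replace M with ((1 + / N) * N) by (rewrite EM; field; lra).
      assert (0 < / N) by (apply Rinv_0_lt_compat; lra).
      rewrite <- Rpower_mult_distr by lra.
      apply Rmult_le_compat_r; [left; apply exp_pos|].
      apply Rpower_Bernoulli; lra. }
    apply Rmult_le_reg_r with (M * Rpower N x); [apply Rmult_lt_0_compat; lra|].
    replace (gauss x (S (S n)) * (x + M) / M * (M * Rpower N x))
      with (gauss x (S (S n)) * (x + M) * Rpower N x) by (field; lra).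
    rewrite E.
    replace (gauss x (S n) * (x + N) / N * (M * Rpower N x))
      with (gauss x (S n) * M * ((1 + x / N) * Rpower N x)) by (field; lra).
    apply Rmult_le_compat_l; [|easy].
    apply Rmult_le_pos; [left; apply Hg|lra]. }
  assert (HB : forall n, gauss x (S n) <= H O).
  { intros n. apply Rle_trans with (H n).
    - unfold H. pose proof (HI n). specialize (Hg n).
      replace (gauss x (S n) * (x + INR (S n)) / INR (S n))
        with (gauss x (S n) + gauss x (S n) * x * / INR (S n)) by (field; lra).
      assert (0 <= gauss x (S n) * x * / INR (S n)); [|lra].
      apply Rmult_le_pos; [apply Rmult_le_pos; lra|].
      left; apply Rinv_0_lt_compat; lra.
    - induction n as [|n IH]; [lra|]. eapply Rle_trans; [apply Hdec|exact IH]. }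
  destruct (ex_finite_lim_seq_incr _ _ Hinc HB) as [L HL].
  exists L. split; [|easy].
  apply Rlt_le_trans with (gauss x 1); [apply Hg|].
  apply (is_lim_seq_incr_compare (fun n => gauss x (S n)) L HL Hinc O).
Qed.

Lemma is_lim_seq_shift_quot (x : R) :
  is_lim_seq (fun n => INR (S n) / (x + INR (S n) + 1)) 1.
Proof.
  apply (is_lim_seq_incr_n _ (S (Z.to_nat (up (Rabs x))))).
  set (K := S (Z.to_nat (up (Rabs x)))).
  assert (HK : Rabs x < INR K).
  { destruct (archimed (Rabs x)) as [A _]. unfold K. rewrite S_INR, INR_IZR_INZ, Z2Nat.id.
    - lra.
    - apply le_IZR. pose proof (Rabs_pos x). lra. }
  assert (Pos : forall n, 0 < x + INR (S (n + K)) + 1).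
  { intros n. rewrite S_INR, plus_INR. pose proof (pos_INR n).
    pose proof (Rle_abs (- x)) as Hx. rewrite Rabs_Ropp in Hx. lra. }
  apply (is_lim_seq_ext (fun n => 1 - (x + 1) * / (x + INR (S (n + K)) + 1))).
  { intros n. specialize (Pos n). field. lra. }
  replace (Finite 1) with (Finite (1 - (x + 1) * 0)) by (f_equal; ring).
  apply is_lim_seq_minus'; [apply is_lim_seq_const|].
  apply is_lim_seq_mult'; [apply is_lim_seq_const|].
  replace (Finite 0) with (Rbar_inv p_infty) by easy.
  apply is_lim_seq_inv; [|easy].
  apply is_lim_seq_le_p_loc with (fun n => INR n); [|apply is_lim_seq_INR].
  exists O. intros n _. rewrite S_INR, plus_INR.
  pose proof (Rle_abs (- x)) as Hx. rewrite Rabs_Ropp in Hx. lra.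
Qed.

Lemma gauss_cv_up (x L : R) : not_pole x ->
  is_lim_seq (fun n => gauss x (S n)) L ->
  is_lim_seq (fun n => gauss (x + 1) (S n)) (x * L).
Proof.
  intros np H.
  apply (is_lim_seq_ext (fun n => x * (INR (S n) / (x + INR (S n) + 1)) * gauss x (S n))).
  - intros n. pose proof (gauss_shift x n np) as E.
    assert (x + INR (S n) + 1 <> 0).
    { pose proof (np (S (S n))) as Q. rewrite S_INR in Q. lra. }
    apply Rmult_eq_reg_r with (x + INR (S n) + 1); [|easy]. rewrite E. field. easy.
  - replace (x * L) with (x * 1 * L) by ring.
    apply is_lim_seq_mult'; [|easy].
    apply is_lim_seq_mult'; [apply is_lim_seq_const|apply is_lim_seq_shift_quot].
Qed.

Lemma gauss_cv_down (x L : R) : not_pole x ->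
  is_lim_seq (fun n => gauss (x + 1) (S n)) L ->
  is_lim_seq (fun n => gauss x (S n)) (L / x).
Proof.
  intros np H. pose proof (np O) as H0. rewrite Rplus_0_r in H0.
  assert (HI : forall n, 0 < INR (S n)) by (intros; apply lt_0_INR; lia).
  assert (np' : forall n, x + INR (S n) + 1 <> 0).
  { intros n. pose proof (np (S (S n))) as Q. rewrite S_INR in Q. lra. }
  apply (is_lim_seq_ext
    (fun n => / x * / (INR (S n) / (x + INR (S n) + 1)) * gauss (x + 1) (S n))).
  - intros n. pose proof (gauss_shift x n np) as E. specialize (HI n).
    apply Rmult_eq_reg_l with (x * INR (S n)); [|apply Rmult_integral_contrapositive; lra].
    rewrite <- E. field. repeat split; auto. lra.
  - replace (L / x) with (/ x * / 1 * L) by (field; easy).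
    apply is_lim_seq_mult'; [|easy].
    apply is_lim_seq_mult'; [apply is_lim_seq_const|].
    apply (is_lim_seq_inv _ 1); [apply is_lim_seq_shift_quot|].
    intros K. injection K. lra.
Qed.

Lemma not_pole_S (x : R) : not_pole x -> not_pole (x + 1).
Proof. intros H j. specialize (H (S j)). rewrite S_INR in H. lra. Qed.

(** The functional equation carries convergence from (0, 1] up to all positive x and then down to
    every x that is not a pole. Each shift multiplies or divides the limit by a nonzero number, so
    it stays nonzero. *)
Lemma gauss_cv (x : R) : not_pole x ->
  exists L, L <> 0 /\ is_lim_seq (fun n => gauss x (S n)) L.
Proof.
  assert (Up : forall n x, 0 < x <= INR n + 1 ->
    exists L, L <> 0 /\ is_lim_seq (fun n => gauss x (S n)) L).
  { induction n as [|n IH]; intros y Hy.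
    - destruct (gauss_cv_unit y) as (L & HL & H); [simpl in Hy; lra|].
      exists L. split; [lra|easy].
    - destruct (Rle_dec y 1) as [q|q].
      + destruct (gauss_cv_unit y) as (L & HL & H); [lra|].
        exists L. split; [lra|easy].
      + rewrite S_INR in Hy. destruct (IH (y - 1)) as (L & HL & H); [lra|].
        exists ((y - 1) * L). split.
        * apply Rmult_integral_contrapositive. split; lra.
        * assert (np : not_pole (y - 1)) by (intros j; pose proof (pos_INR j); lra).
          pose proof (gauss_cv_up _ L np H) as Q.
          now replace (y - 1 + 1) with y in Q by ring. }
  assert (Down : forall n x, - INR n < x -> not_pole x ->
    exists L, L <> 0 /\ is_lim_seq (fun n => gauss x (S n)) L).
  { induction n as [|n IH]; intros y Hy np.
    - destruct (archimed y) as [A _].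
      apply (Up (Z.to_nat (up y))). simpl in Hy.
      rewrite INR_IZR_INZ, Z2Nat.id; [lra|]. apply le_IZR. lra.
    - rewrite S_INR in Hy.
      destruct (IH (y + 1)) as (L & HL & H); [lra|now apply not_pole_S|].
      exists (L / y). split; [|now apply gauss_cv_down].
      pose proof (np O) as H0. rewrite Rplus_0_r in H0.
      apply Rmult_integral_contrapositive. split; [easy|now apply Rinv_neq_0_compat]. }
  intros np. destruct (archimed (Rabs x)) as [A _].
  apply (Down (Z.to_nat (up (Rabs x)))); [|easy].
  rewrite INR_IZR_INZ, Z2Nat.id.
  - pose proof (Rle_abs (- x)) as Hx. rewrite Rabs_Ropp in Hx. lra.
  - apply le_IZR. pose proof (Rabs_pos x). lra.
Qed.

Lemma Gamma_of_lim (x L : R) : is_lim_seq (fun n => gauss x (S n)) L -> Gamma x = L.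
Proof.
  intros H. apply (is_lim_seq_incr_1 (gauss x) L) in H.
  unfold Gamma. change (real (Lim_seq (gauss x)) = L).
  now rewrite (is_lim_seq_unique _ _ H).
Qed.

Lemma Gamma_neq_0 (x : R) : not_pole x -> Gamma x <> 0.
Proof.
  intros np. destruct (gauss_cv x np) as (L & HL & H).
  now rewrite (Gamma_of_lim x L H).
Qed.

Lemma Gamma_S (x : R) : not_pole x -> Gamma (x + 1) = x * Gamma x.
Proof.
  intros np. destruct (gauss_cv x np) as (L & HL & H).
  rewrite (Gamma_of_lim x L H). now apply Gamma_of_lim, gauss_cv_up.
Qed.

Lemma Gamma_1 : Gamma 1 = 1.
Proof.
  apply Gamma_of_lim.
  apply (is_lim_seq_ext (fun n => INR (S n) / (0 + INR (S n) + 1)));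
    [|apply is_lim_seq_shift_quot].
  intros n. unfold gauss.
  assert (HN : 0 < INR (S n)) by (apply lt_0_INR; lia).
  rewrite Rpower_1 by easy.
  assert (E : forall N, prod_f_R0 (fun j => 1 + INR j) N = INR (fact N) * (INR N + 1)).
  { induction N as [|N IH]; [simpl; ring|].
    cbn [prod_f_R0]. rewrite IH.
    change (fact (S N)) with (S N * fact N)%nat. rewrite mult_INR, !S_INR. ring. }
  rewrite E. field. repeat split; try lra; apply INR_fact_neq_0.
Qed.

Lemma Gamma_fact (n : nat) : Gamma (INR n + 1) = INR (fact n).
Proof.
  induction n as [|n IH].
  - simpl. rewrite Rplus_0_l. apply Gamma_1.
  - rewrite Gamma_S, S_INR, IH.
    + change (fact (S n)) with (S n * fact n)%nat. now rewrite mult_INR, S_INR.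
    + intros j. pose proof (pos_INR (S n)). pose proof (pos_INR j).
      rewrite S_INR. pose proof (pos_INR n). lra.
Qed.

Lemma Gamma_falling (w : R) (n : nat) : not_pole (w - INR n + 1) ->
  Gamma (w + 1) = falling w n * Gamma (w - INR n + 1).
Proof.
  induction n as [|n IH]; intros np.
  - simpl. rewrite Rminus_0_r. ring.
  - rewrite S_INR in np |- *.
    assert (np' : not_pole (w - INR n)).
    { intros j. specialize (np j). lra. }
    rewrite IH, falling_S_r, Gamma_S by (auto; now apply not_pole_S).
    replace (w - (INR n + 1) + 1) with (w - INR n) by ring. ring.
Qed.

(** * Generalized binomials as polynomials *)

Lemma falling_continuous (n : nat) (z : R) :
  continuous (fun w => falling w n) z.
Proof.
  revert z; induction n as [|n IH]; intros z; [apply continuous_const|].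
  apply (continuous_mult (fun w => w) (fun w => falling (w - 1) n)).
  - apply continuous_id.
  - apply (continuous_comp (fun w => w - 1) (fun w => falling w n)); [|apply IH].
    apply (continuous_minus (fun w => w) (fun _ => 1));
      [apply continuous_id|apply continuous_const].
Qed.

Lemma is_lim_seq_approach (z : R) : is_lim_seq (fun n => z + / (INR n + 1)) z.
Proof. apply (is_lim_seq_Rbar_loc_seq z). Qed.

(** [Lim] at z is computed along w = z + 1/(m+1). Eventually w lies strictly between the consecutive
    integers [up z - 1] and [up z], so no pole is met and the Gamma quotient is a falling factorial,
    which is continuous in w. *)
Lemma gbinom_eq (z : R) (n : nat) : gbinom z n = falling z n / INR (fact n).
Proof.
  unfold gbinom, Lim.
  enough (H : is_lim_seq (fun m =>
    Gamma (Rbar_loc_seq z m + 1) / (Gamma (INR n + 1) * Gamma (Rbar_loc_seq z m - INR n + 1)))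
    (falling z n / INR (fact n))) by now rewrite (is_lim_seq_unique _ _ H).
  assert (Hc : is_lim_seq (fun m => falling (z + / (INR m + 1)) n / INR (fact n))
                          (falling z n / INR (fact n))).
  { apply is_lim_seq_mult'; [|apply is_lim_seq_const].
    apply (is_lim_seq_continuous (fun w => falling w n)); [|apply is_lim_seq_approach].
    apply continuity_pt_filterlim, falling_continuous. }
  apply (is_lim_seq_ext_loc _ _ _) with (2 := Hc).
  assert (Hu : eventually (fun m => z + / (INR m + 1) < IZR (up z))).
  { destruct (archimed z) as [A B].
    destruct (proj2 (is_lim_seq_spec _ _) (is_lim_seq_approach z)
      (mkposreal (IZR (up z) - z) ltac:(lra))) as [N HN].
    exists N. intros m Hm. specialize (HN m Hm). simpl in HN.
    apply Rabs_lt_between in HN. lra. }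
  revert Hu. apply filter_imp. intros m Hm. simpl.
  assert (Hm0 : 0 < / (INR m + 1)).
  { apply Rinv_0_lt_compat. pose proof (pos_INR m). lra. }
  set (w := z + / (INR m + 1)) in *.
  assert (np : not_pole (w - INR n + 1)).
  { intros j K. destruct (archimed z) as [A B].
    assert (E : w = IZR (Z.of_nat n - 1 - Z.of_nat j)).
    { rewrite !minus_IZR, <- !INR_IZR_INZ. lra. }
    assert (Hw1 : IZR (up z - 1) < w) by (rewrite minus_IZR; unfold w; lra).
    rewrite E in Hw1, Hm. apply lt_IZR in Hw1, Hm. lia. }
  rewrite (Gamma_falling w n np), Gamma_fact.
  field. split; [now apply Gamma_neq_0|apply INR_fact_neq_0].
Qed.

Lemma gbinom_div_0 (z : R) : z <> 0 -> gbinom_div z 0 = / z.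
Proof.
  intros H. unfold gbinom_div. destruct (Req_EM_T z 0); [easy|].
  rewrite gbinom_eq. simpl. field. easy.
Qed.

(** The factor z of the falling factorial cancels the denominator; what is left is continuous, so
    the same formula gives the limit at z = 0. *)
Lemma gbinom_div_S (z : R) (s : nat) :
  gbinom_div z (S s) = falling (z - 1) s / INR (fact (S s)).
Proof.
  unfold gbinom_div.
  assert (F := INR_fact_neq_0 (S s)).
  destruct (Req_EM_T z 0) as [->|H].
  - enough (L : is_lim_seq (fun m => gbinom (Rbar_loc_seq 0 m) (S s) / Rbar_loc_seq 0 m)
        (falling (0 - 1) s / INR (fact (S s)))).
    { unfold Lim. now rewrite (is_lim_seq_unique _ _ L). }
    apply (is_lim_seq_ext (fun m => falling (0 + / (INR m + 1) - 1) s / INR (fact (S s)))).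
    + intros m. cbn [Rbar_loc_seq]. rewrite gbinom_eq.
      set (w := 0 + / (INR m + 1)).
      assert (w <> 0).
      { unfold w. rewrite Rplus_0_l. apply Rinv_neq_0_compat.
        pose proof (pos_INR m). lra. }
      change (falling w (S s)) with (w * falling (w - 1) s). field. easy.
    + apply is_lim_seq_mult'; [|apply is_lim_seq_const].
      apply (is_lim_seq_continuous (fun w => falling (w - 1) s)); [|apply is_lim_seq_approach].
      apply continuity_pt_filterlim.
      apply (continuous_comp (fun w => w - 1) (fun w => falling w s));
        [|apply falling_continuous].
      apply (continuous_minus (fun w => w) (fun _ => 1));
        [apply continuous_id|apply continuous_const].
  - rewrite gbinom_eq. change (falling z (S s)) with (z * falling (z - 1) s).
    field. easy.
Qed.

(** * Series for powers of V *)

Lemma falling_Rabs_le (z : R) (n : nat) :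
  Rabs (falling z n) <= (Rabs z + INR n) ^ n.
Proof.
  revert z; induction n as [|n IH]; intros z.
  - simpl. rewrite Rabs_R1. lra.
  - change (falling z (S n)) with (z * falling (z - 1) n).
    rewrite Rabs_mult, S_INR. simpl.
    pose proof (pos_INR n). pose proof (Rabs_pos z).
    apply Rmult_le_compat; try apply Rabs_pos; [lra|].
    eapply Rle_trans; [apply IH|]. apply pow_incr.
    pose proof (Rabs_pos (z - 1)).
    pose proof (Rabs_triang z (- (1))) as T.
    rewrite Rabs_Ropp, Rabs_R1 in T. unfold Rminus. unfold Rminus in *. lra.
Qed.

Lemma falling_nonneg (z : R) (n : nat) : INR n - 1 <= z -> 0 <= falling z n.
Proof.
  revert z; induction n as [|n IH]; intros z Hz; [simpl; lra|].
  change (0 <= z * falling (z - 1) n). rewrite S_INR in Hz.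
  pose proof (pos_INR n). apply Rmult_le_pos; [lra|]. apply IH. lra.
Qed.

Lemma pow_div_fact_le_exp (y : R) (m : nat) : 0 <= y -> y ^ m / INR (fact m) <= exp y.
Proof.
  intros Hy.
  assert (E : is_series (fun n => y ^ n / INR (fact n)) (exp y)).
  { apply (is_series_ext (fun n => scal (pow_n y n) (/ INR (fact n)))).
    - intros n. rewrite pow_n_pow. easy.
    - apply is_exp_Reals. }
  rewrite <- (is_series_unique _ _ E).
  apply (term_le_Series (fun n => y ^ n / INR (fact n))).
  - intros n. apply Rmult_le_pos; [now apply pow_le|].
    left. apply Rinv_0_lt_compat, INR_fact_lt_0.
  - now exists (exp y).
Qed.

Lemma exp_INR_mult (y : R) (m : nat) : exp (INR m * y) = exp y ^ m.
Proof.
  induction m as [|m IH]; [simpl; now rewrite Rmult_0_l, exp_0|].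
  rewrite S_INR. simpl. rewrite <- IH, <- exp_plus. f_equal. ring.
Qed.

(** With m = i + j and y = |x| + 3 m, the numerator is at most y^m <= m! exp y. Of the 3, two units
    come from r, q <= 2 and one from the descent in the falling factorial. *)
Lemma Vcoef_bound (r q : R) (i j : nat) (x : R) :
  0 <= r <= 2 -> 0 <= q <= 2 ->
  Rabs (Vcoef r q i j x) <=
  exp (Rabs x) * exp 3 ^ (i + j) * (INR (fact (i + j)) / (INR (fact i) * INR (fact j))).
Proof.
  intros Hr Hq.
  assert (F : forall n, 0 < INR (fact n)) by exact INR_fact_lt_0.
  unfold Vcoef. destruct (i + j)%nat as [|m] eqn:Em.
  - assert (i = 0%nat /\ j = 0%nat) as [-> ->] by lia.
    rewrite Rabs_R1. simpl.
    pose proof (exp_ineq1_le (Rabs x)). pose proof (Rabs_pos x). lra.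
  - set (z := x + r * INR i + q * INR j).
    assert (Hz : Rabs z <= Rabs x + 2 * INR (S m)).
    { unfold z. rewrite <- Em, plus_INR.
      pose proof (pos_INR i). pose proof (pos_INR j).
      eapply Rle_trans; [apply Rabs_triang|].
      assert (Rabs (q * INR j) <= 2 * INR j).
      { rewrite Rabs_pos_eq; [apply Rmult_le_compat_r; lra|apply Rmult_le_pos; lra]. }
      assert (Rabs (x + r * INR i) <= Rabs x + 2 * INR i); [|lra].
      eapply Rle_trans; [apply Rabs_triang|]. apply Rplus_le_compat_l.
      rewrite Rabs_pos_eq; [apply Rmult_le_compat_r; lra|apply Rmult_le_pos; lra]. }
    set (y := Rabs x + 3 * INR (S m)).
    pose proof (Rabs_pos x). pose proof (pos_INR m). pose proof (pos_INR (S m)).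
    assert (Hnum : Rabs (x * falling (z - 1) m) <= y ^ S m).
    { rewrite Rabs_mult. simpl. apply Rmult_le_compat; try apply Rabs_pos.
      - unfold y. lra.
      - eapply Rle_trans; [apply falling_Rabs_le|]. apply pow_incr.
        pose proof (Rabs_pos (z - 1)).
        pose proof (Rabs_triang z (- (1))) as T.
        rewrite Rabs_Ropp, Rabs_R1 in T. unfold y. rewrite S_INR in *.
        unfold Rminus in *. lra. }
    assert (Hy : y ^ S m <= INR (fact (S m)) * (exp (Rabs x) * exp 3 ^ S m)).
    { rewrite <- exp_INR_mult, <- exp_plus.
      replace (Rabs x + INR (S m) * 3) with y by (unfold y; ring).
      pose proof (pow_div_fact_le_exp y (S m) ltac:(unfold y; lra)) as Q.
      apply (Rmult_le_compat_l (INR (fact (S m)))) in Q; [|left; apply F].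
      replace (INR (fact (S m)) * (y ^ S m / INR (fact (S m)))) with (y ^ S m) in Q;
        [easy|]. field. apply INR_fact_neq_0. }
    unfold Rdiv. rewrite (Rabs_mult (x * falling (z - 1) m)).
    assert (Fij : 0 < / (INR (fact i) * INR (fact j))).
    { apply Rinv_0_lt_compat, Rmult_lt_0_compat; apply F. }
    rewrite (Rabs_pos_eq (/ _)) by lra.
    replace (exp (Rabs x) * exp 3 ^ S m * (INR (fact (S m)) * / (INR (fact i) * INR (fact j))))
      with (INR (fact (S m)) * (exp (Rabs x) * exp 3 ^ S m) * / (INR (fact i) * INR (fact j)))
      by ring.
    apply Rmult_le_compat_r; lra.
Qed.

Lemma Cmod_Csum_le (u : nat -> C) (b : nat -> R) (n : nat) :
  (forall i, (i <= n)%nat -> Cmod (u i) <= b i) ->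
  Cmod (Csum u (S n)) <= sum_f_R0 b n.
Proof.
  induction n as [|n IH]; intros H.
  - simpl. rewrite Cplus_0_l. now apply H.
  - change (Csum u (S (S n))) with (Csum u (S n) + u (S n))%C.
    eapply Rle_trans; [apply Cmod_triangle|]. simpl.
    apply Rplus_le_compat; [|now apply H]. apply IH. intros i Hi. apply H. lia.
Qed.

(** The factorials in the bound for [Vcoef] are binomial coefficients, so the sum over j is a power
    of |a| + |b|. *)
Lemma Vhom_bound (r q : R) (a b : C) (m : nat) (x : R) :
  0 <= r <= 2 -> 0 <= q <= 2 ->
  Cmod (Vhom r q a b m x) <= exp (Rabs x) * (exp 3 * (Cmod a + Cmod b)) ^ m.
Proof.
  intros Hr Hq. unfold Vhom.
  eapply Rle_trans; [apply (Cmod_Csum_le _ (fun j =>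
    (Binomial.C m j * Cmod b ^ j * Cmod a ^ (m - j)) * (exp (Rabs x) * exp 3 ^ m)))|].
  - intros j Hj. rewrite !Cmod_mult, !Cmod_pow, Cmod_R.
    pose proof (Vcoef_bound r q (m - j) j x Hr Hq) as B.
    replace (m - j + j)%nat with m in B by lia.
    unfold Binomial.C.
    replace (INR (fact m) / (INR (fact j) * INR (fact (m - j))) * Cmod b ^ j
       * Cmod a ^ (m - j) * (exp (Rabs x) * exp 3 ^ m))
      with (exp (Rabs x) * exp 3 ^ m * (INR (fact m) / (INR (fact (m - j)) * INR (fact j)))
            * (Cmod a ^ (m - j) * Cmod b ^ j))
      by (field; split; apply INR_fact_neq_0).
    apply Rmult_le_compat_r; [|exact B].
    apply Rmult_le_pos; apply pow_le, Cmod_ge_0.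
  - rewrite <- scal_sum, <- binomial, Rpow_mult_distr. right.
    rewrite (Rplus_comm (Cmod b)). ring.
Qed.

(** Formally V^x at (s a, s b), since s marks the total degree. *)
Definition Vsum (r q : R) (a b : C) (x : R) (s : C) : C :=
  CSeries (fun m => Vhom r q a b m x * s ^ m)%C.

Definition Vsummable (r q : R) (a b : C) (x : R) (s : C) : Prop :=
  summable (fun m => Vhom r q a b m x * s ^ m)%C.

Lemma Vsummable_small (r q : R) (a b : C) (x : R) (s : C) :
  0 <= r <= 2 -> 0 <= q <= 2 -> exp 3 * (Cmod a + Cmod b) * Cmod s < 1 ->
  Vsummable r q a b x s.
Proof.
  intros Hr Hq Hs.
  apply (summable_le _ (fun m => exp (Rabs x) * (exp 3 * (Cmod a + Cmod b) * Cmod s) ^ m)).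
  - intros m. rewrite Cmod_mult, Cmod_pow, (Rpow_mult_distr _ (Cmod s)), <- Rmult_assoc.
    apply Rmult_le_compat_r; [apply pow_le, Cmod_ge_0|]. now apply Vhom_bound.
  - apply (ex_series_scal_l (exp (Rabs x))
      (fun m => (exp 3 * (Cmod a + Cmod b) * Cmod s) ^ m)), ex_series_geom.
    rewrite Rabs_pos_eq; [easy|].
    pose proof (Cmod_ge_0 a). pose proof (Cmod_ge_0 b). pose proof (exp_pos 3).
    repeat apply Rmult_le_pos; try lra. apply Cmod_ge_0.
Qed.

Lemma Vsum_plus (r q : R) (a b : C) (x y : R) (s : C) :
  Vsummable r q a b x s -> Vsummable r q a b y s ->
  Vsummable r q a b (x + y) s /\
  Vsum r q a b (x + y) s = (Vsum r q a b x s * Vsum r q a b y s)%C.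
Proof.
  intros Hx Hy. unfold Vsummable, Vsum.
  destruct (CSeries_conv _ _ Hx Hy) as (H1 & H2 & _).
  assert (E : forall m, conv (fun m => Vhom r q a b m x * s ^ m)%C
      (fun m => Vhom r q a b m y * s ^ m)%C m = (Vhom r q a b m (x + y) * s ^ m)%C).
  { intros m. now rewrite <- Vhom_conv, conv_geom. }
  split; [exact (summable_ext _ _ E H1)|].
  now rewrite <- H2, (CSeries_ext _ _ E).
Qed.

Lemma Vsum_0 (r q : R) (a b : C) (s : C) :
  Vsummable r q a b 0 s /\ Vsum r q a b 0 s = RtoC 1.
Proof.
  assert (H : forall n, (1 <= n)%nat -> (Vhom r q a b n 0 * s ^ n)%C = RtoC 0).
  { intros [|n] Hn; [lia|]. rewrite Vhom_S_0. ring. }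
  split; [exact (summable_finite _ 1 H)|].
  unfold Vsum. rewrite (CSeries_finite _ 1 H). simpl. rewrite Vhom_O. ring.
Qed.

Lemma Vsum_INR (r q : R) (a b : C) (x : R) (s : C) (n : nat) :
  Vsummable r q a b x s ->
  Vsummable r q a b (INR n * x) s /\
  Vsum r q a b (INR n * x) s = (Vsum r q a b x s ^ n)%C.
Proof.
  intros Hx. induction n as [|n [I1 I2]].
  - simpl. rewrite Rmult_0_l. apply Vsum_0.
  - rewrite S_INR. replace ((INR n + 1) * x) with (x + INR n * x) by ring.
    destruct (Vsum_plus r q a b x (INR n * x) s Hx I1) as [J1 J2].
    split; [easy|]. now rewrite J2, I2.
Qed.

(** The recurrence of [Vhom_diff] at x = 0, where V^0 contributes only the constant 1. *)
Lemma Vsum_trinomial (r q : R) (a b : C) (s : C) :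
  Vsummable r q a b 1 s -> Vsummable r q a b r s -> Vsummable r q a b q s ->
  Vsum r q a b 1 s =
  (RtoC 1 + s * (a * Vsum r q a b r s + b * Vsum r q a b q s))%C.
Proof.
  intros H1 Hr Hq. unfold Vsum at 1. rewrite CSeries_incr_1 by exact H1.
  rewrite Vhom_O. simpl (s ^ 0)%C. rewrite Cmult_1_r. f_equal.
  unfold Vsum. rewrite <- !CSeries_scal, <- CSeries_plus, <- CSeries_scal; auto.
  - apply CSeries_ext. intros m.
    pose proof (Vhom_diff r q a b m 0) as E. rewrite !Rplus_0_l in E.
    rewrite E, Vhom_S_0. simpl. ring.
  - apply summable_plus; now apply summable_scal.
  - now apply summable_scal.
  - now apply summable_scal.
Qed.

(** The exponents 1, r and q are all integer multiples of x, so the defining equation of V becomes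
    polynomial in Y = V^x. It is used with x = 1/(nu-1). *)
Lemma Vsum_root (r q : R) (a b : C) (s : C) (x : R) (p n1 n2 : nat) :
  INR p * x = 1 -> INR n1 * x = r -> INR n2 * x = q -> Vsummable r q a b x s ->
  let Y := Vsum r q a b x s in
  (Y ^ p = RtoC 1 + s * (a * Y ^ n1 + b * Y ^ n2))%C.
Proof.
  intros Hp H1 H2 Hx Y.
  destruct (Vsum_INR r q a b x s p Hx) as [Sp Ep].
  destruct (Vsum_INR r q a b x s n1 Hx) as [S1 E1].
  destruct (Vsum_INR r q a b x s n2 Hx) as [S2 E2].
  rewrite Hp in Sp, Ep. rewrite H1 in S1, E1. rewrite H2 in S2, E2.
  unfold Y. rewrite <- Ep, <- E1, <- E2. now apply Vsum_trinomial.
Qed.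

Lemma Vhom_single (r q : R) (m : nat) (x : R) :
  Vhom r q (RtoC 1) (RtoC 0) m x = RtoC (Vcoef r q m 0 x).
Proof.
  unfold Vhom. rewrite Csum_S_l, Nat.sub_0_r, Cpow_1_l, Csum_zero.
  - simpl. ring.
  - intros i Hi. simpl. ring.
Qed.

(* V^(1/(nu-1)) for V = 1 + a V^(nu/(nu-1)), i.e. the coefficients of 1/BR nu (-a). *)
Definition beta (nu n : nat) : R := Vcoef (k1 nu) (k1 nu) n 0 (/ (INR nu - 1)).

(** The leading factor (nu n + 1)/(nu - 1) of the falling factorial cancels the denominator nu n + 1
    and leaves the factor x = 1/(nu-1) of [Vcoef]. *)
Lemma BR_coef_beta (nu n : nat) : (1 < nu)%nat -> BR_coef nu n = beta nu n.
Proof.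
  intros Hnu. unfold BR_coef, beta, Vcoef. rewrite gbinom_eq, Nat.add_0_r.
  assert (H : 1 < INR nu) by (apply (lt_INR 1); easy).
  destruct n as [|m]; [simpl; field|].
  set (z := (INR nu * INR (S m) + 1) / (INR nu - 1)).
  change (falling z (S m)) with (z * falling (z - 1) m).
  replace (/ (INR nu - 1) + k1 nu * INR (S m) + k1 nu * INR 0) with z
    by (unfold z, k1; simpl (INR 0); field; lra).
  pose proof (pos_INR (S m)).
  assert (0 <= INR nu * INR (S m)) by (apply Rmult_le_pos; lra).
  unfold z at 1. change (INR (fact 0)) with 1. field.
  repeat split; try lra. apply INR_fact_neq_0.
Qed.

Lemma beta_nonneg (nu n : nat) : (1 < nu)%nat -> 0 <= beta nu n.
Proof.
  intros Hnu. unfold beta, Vcoef. rewrite Nat.add_0_r.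
  assert (H : 1 < INR nu) by (apply (lt_INR 1); easy).
  assert (Hx : 0 < / (INR nu - 1)) by (apply Rinv_0_lt_compat; lra).
  destruct n as [|m]; [lra|].
  apply Rmult_le_pos.
  - apply Rmult_le_pos; [lra|]. apply falling_nonneg.
    assert (Hk : 1 <= k1 nu).
    { unfold k1. apply Rmult_le_reg_r with (INR nu - 1); [lra|].
      replace (INR nu / (INR nu - 1) * (INR nu - 1)) with (INR nu) by (field; lra). lra. }
    pose proof (pos_INR m). rewrite S_INR. simpl (INR 0).
    assert (1 * (INR m + 1) <= k1 nu * (INR m + 1)) by (apply Rmult_le_compat_r; lra).
    lra.
  - left. apply Rinv_0_lt_compat, Rmult_lt_0_compat; apply INR_fact_lt_0.
Qed.

Lemma k1_bounds (nu : nat) : (1 < nu)%nat -> 0 <= k1 nu <= 2.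
Proof.
  intros Hnu. assert (H : 2 <= INR nu) by (apply (le_INR 2); easy).
  assert (0 < / (INR nu - 1) <= 1).
  { split; [apply Rinv_0_lt_compat; lra|]. rewrite <- Rinv_1.
    apply Rinv_le_contravar; lra. }
  replace (k1 nu) with (1 + / (INR nu - 1)); [lra|]. unfold k1. field. lra.
Qed.

(** The sum is (nu-mu)/(nu-1), the exponent q of V; the range is the one that the coefficient bounds
    ask for. *)
Lemma k1_lambda1_bounds (nu mu : nat) : (0 < mu)%nat -> (mu < nu)%nat ->
  0 <= k1 nu + lambda1 nu mu <= 2.
Proof.
  intros Hmu Hnu. pose proof (k1_bounds nu ltac:(lia)).
  assert (H1 : 1 <= INR mu) by (apply (le_INR 1); easy).
  assert (H2 : INR mu + 1 <= INR nu) by (rewrite <- S_INR; apply le_INR; lia).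
  assert (0 < / (INR nu - 1)) by (apply Rinv_0_lt_compat; lra).
  assert (lambda1 nu mu <= 0).
  { unfold lambda1, Rdiv. rewrite Ropp_mult_distr_l_reverse.
    assert (0 <= INR mu * / (INR nu - 1)); [apply Rmult_le_pos|]; lra. }
  split; [|lra].
  replace (k1 nu + lambda1 nu mu) with ((INR nu - INR mu) * / (INR nu - 1))
    by (unfold k1, lambda1; field; lra).
  apply Rmult_le_pos; lra.
Qed.

(** The index n = j + 1 of the series for f belongs to a^(s-j) b^j: n/n! gives 1/j!, the quotient by
    s - n + 1 gives 1/(s-j)!, and k1 s + lambda1 (j+1) = lambda1 + k1 (s-j) + (k1 + lambda1) j
    matches the falling factorials. *)
Lemma f_coef_Vcoef (nu mu s j : nat) : (0 < mu)%nat -> (mu < nu)%nat -> (j <= s)%nat ->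
  lambda1 nu mu * f_coef nu mu s (S j) =
  Vcoef (k1 nu) (k1 nu + lambda1 nu mu) (s - j) j (lambda1 nu mu).
Proof.
  intros Hmu Hnu Hj.
  assert (H1 : 1 <= INR mu) by (apply (le_INR 1); easy).
  assert (H2 : INR mu + 1 <= INR nu) by (rewrite <- S_INR; apply le_INR; lia).
  assert (Hl : lambda1 nu mu <> 0).
  { unfold lambda1. apply Rmult_integral_contrapositive. split; [lra|].
    apply Rinv_neq_0_compat. lra. }
  assert (F : forall n, INR (fact n) <> 0) by exact INR_fact_neq_0.
  unfold f_coef, binom_div_succ, Vcoef.
  rewrite (proj2 (Nat.leb_le (S j) (s + 1))) by lia.
  replace (s - j + j)%nat with s by lia.
  replace (s + 1 - S j)%nat with (s - j)%nat by lia.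
  destruct s as [|s].
  - assert (j = 0%nat) as -> by lia. rewrite gbinom_div_0.
    + simpl. field. simpl. lra.
    + simpl. lra.
  - rewrite gbinom_div_S.
    replace (lambda1 nu mu + k1 nu * INR (S s - j) + (k1 nu + lambda1 nu mu) * INR j)
      with (k1 nu * INR (S s) + lambda1 nu mu * INR (S j))
      by (rewrite minus_INR, (S_INR j) by lia; ring).
    set (P := falling _ s).
    change (fact (S j)) with (S j * fact j)%nat. rewrite (mult_INR (S j)).
    pose proof (pos_INR j). assert (INR (S j) <> 0) by (rewrite S_INR; lra).
    field. repeat split; auto.
Qed.

Lemma f_coef_0 (nu mu s j : nat) : (s < j)%nat -> f_coef nu mu s (S j) = 0.
Proof.
  intros Hj. unfold f_coef, binom_div_succ.
  rewrite (proj2 (Nat.leb_gt (S j) (s + 1))) by lia. ring.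
Qed.

(** With a = -l and b = -k, the sign (-1)^s is split between the powers of a and b, and l
    (k/l)^(j+1) l^s = k k^j l^(s-j) leaves one factor k in front. *)
Lemma g_term_Vhom (nu mu : nat) (k l : C) (s : nat) :
  (0 < mu)%nat -> (mu < nu)%nat -> l <> RtoC 0 ->
  (RtoC (lambda1 nu mu) * l * g_term nu mu k l s =
   k * Vhom (k1 nu) (k1 nu + lambda1 nu mu) (- l) (- k) s (lambda1 nu mu))%C.
Proof.
  intros Hmu Hnu Hl. unfold g_term, Defs.f, Vhom.
  rewrite (CSeries_finite _ (S s)).
  2:{ intros n Hn. rewrite f_coef_0 by lia. ring. }
  rewrite <- (Csum_scal k).
  match goal with |- ?L = _ => replace L with
    ((RtoC (lambda1 nu mu) * l * (- RtoC 1) ^ s * l ^ s) *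
      Csum (fun m => RtoC (f_coef nu mu s (S m)) * (k * / l) ^ S m) (S s))%C by ring end.
  rewrite <- Csum_scal. apply Csum_ext. intros j Hj.
  rewrite <- f_coef_Vcoef by lia. rewrite RtoC_mult.
  replace (- l)%C with (- RtoC 1 * l)%C by ring.
  replace (- k)%C with (- RtoC 1 * k)%C by ring.
  rewrite !Cpow_mult_l, Cpow_inv by easy.
  replace ((- RtoC 1) ^ s)%C with ((- RtoC 1) ^ (s - j) * (- RtoC 1) ^ j)%C
    by (rewrite <- Cpow_add_r; f_equal; lia).
  replace (l ^ s)%C with (l ^ (s - j) * l ^ j)%C
    by (rewrite <- Cpow_add_r; f_equal; lia).
  simpl. field. split; [now apply Cpow_nz|easy].
Qed.

(** The quotient k/l does not change along the segment, so only the power of l contributes. *)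
Lemma g_term_scale (nu mu : nat) (k l : C) (t : R) (s : nat) :
  t <> 0 -> l <> RtoC 0 ->
  g_term nu mu (RtoC t * k) (RtoC t * l) s = (g_term nu mu k l s * RtoC t ^ s)%C.
Proof.
  intros Ht Hl. unfold g_term.
  replace (RtoC t * k * / (RtoC t * l))%C with (k * / l)%C.
  - rewrite Cpow_mult_l. ring.
  - field. split; [easy|]. intros K. apply RtoC_inj in K. easy.
Qed.

(** * Limits and boundary values *)

Lemma sum_n_Re_Im (u : nat -> C) (n : nat) :
  @sum_n C_NormedModule u n
  = (sum_n (fun n => Re (u n)) n, sum_n (fun n => Im (u n)) n).
Proof.
  induction n as [|n IH].
  - rewrite !sum_O. apply surjective_pairing.
  - rewrite !sum_Sn, IH. easy.
Qed.

Lemma ex_Cseries_iff (u : nat -> C) :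
  ex_Cseries u <-> ex_series (fun n => Re (u n)) /\ ex_series (fun n => Im (u n)).
Proof.
  split.
  - intros [L HL].
    assert (B : forall eps : posreal, eventually (fun n =>
      ball (Re L) eps (sum_n (fun n => Re (u n)) n) /\
      ball (Im L) eps (sum_n (fun n => Im (u n)) n))).
    { intros eps. pose proof (proj1 (filterlim_locally _ _) HL eps) as H.
      revert H. apply filter_imp. intros n H. rewrite sum_n_Re_Im in H. exact H. }
    split; [exists (Re L)|exists (Im L)]; apply filterlim_locally; intros eps;
      generalize (B eps); apply filter_imp; tauto.
  - intros [[x Hx] [y Hy]]. exists (x, y).
    apply filterlim_locally. intros eps.
    pose proof (proj1 (filterlim_locally _ _) Hx eps) as H1.
    pose proof (proj1 (filterlim_locally _ _) Hy eps) as H2.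
    generalize (filter_and _ _ H1 H2). apply filter_imp. intros n [K1 K2].
    rewrite sum_n_Re_Im. split; assumption.
Qed.

Lemma summable_ex_Cseries (u : nat -> C) : summable u -> ex_Cseries u.
Proof.
  intros H. apply ex_Cseries_iff. split; [now apply summable_Re|now apply summable_Im].
Qed.

Lemma CV_radius_ge (a : nat -> R) (t : R) :
  0 <= t -> ex_series (fun n => a n * t ^ n) -> Rbar_le t (CV_radius a).
Proof.
  intros Ht H. apply Rbar_not_lt_le. intros K.
  apply (CV_disk_outside a t).
  - now rewrite Rabs_pos_eq.
  - now apply ex_series_lim_0.
Qed.

Definition Clim (u : nat -> C) (L : C) : Prop :=
  is_lim_seq (fun n => Cmod (u n - L)%C) 0.

Lemma Clim_le (u : nat -> C) (L : C) (v : nat -> R) :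
  (forall n, Cmod (u n - L)%C <= v n) -> is_lim_seq v 0 -> Clim u L.
Proof.
  intros H Hv. apply (is_lim_seq_le_le (fun _ => 0) _ v); [|apply is_lim_seq_const|easy].
  intros n. split; [apply Cmod_ge_0|apply H].
Qed.

Lemma Clim_const (c : C) : Clim (fun _ => c) c.
Proof.
  apply (Clim_le _ _ (fun _ => 0)); [|apply is_lim_seq_const].
  intros _. replace (c - c)%C with (RtoC 0) by ring. rewrite Cmod_0. lra.
Qed.

Lemma Clim_plus (u v : nat -> C) (L M : C) :
  Clim u L -> Clim v M -> Clim (fun n => u n + v n)%C (L + M)%C.
Proof.
  intros Hu Hv.
  apply (Clim_le _ _ (fun n => Cmod (u n - L)%C + Cmod (v n - M)%C)).
  - intros n. replace (u n + v n - (L + M))%C with ((u n - L) + (v n - M))%C by ring.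
    apply Cmod_triangle.
  - replace 0 with (0 + 0) by ring. now apply is_lim_seq_plus'.
Qed.

Lemma Clim_mult (u v : nat -> C) (L M : C) :
  Clim u L -> Clim v M -> Clim (fun n => u n * v n)%C (L * M)%C.
Proof.
  intros Hu Hv.
  apply (Clim_le _ _ (fun n => Cmod (u n - L)%C * Cmod (v n - M)%C
    + Cmod (u n - L)%C * Cmod M + Cmod L * Cmod (v n - M)%C)).
  - intros n. replace (u n * v n - (L * M))%C
      with ((u n - L) * (v n - M) + (u n - L) * M + L * (v n - M))%C by ring.
    rewrite <- !Cmod_mult.
    eapply Rle_trans; [apply Cmod_triangle|]. apply Rplus_le_compat_r, Cmod_triangle.
  - replace 0 with (0 * 0 + 0 * Cmod M + Cmod L * 0) by ring.
    apply is_lim_seq_plus'; [apply is_lim_seq_plus'|]; apply is_lim_seq_mult';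
      first [exact Hu|exact Hv|exact (is_lim_seq_const _)].
Qed.

Lemma Clim_opp (u : nat -> C) (L : C) : Clim u L -> Clim (fun n => - u n)%C (- L)%C.
Proof.
  intros H. apply (Clim_le _ _ (fun n => Cmod (u n - L)%C)); [|easy].
  intros n. replace (- u n - - L)%C with (- (u n - L))%C by ring. rewrite Cmod_opp. lra.
Qed.

Lemma Clim_pow (u : nat -> C) (L : C) (n : nat) :
  Clim u L -> Clim (fun j => u j ^ n)%C (L ^ n)%C.
Proof.
  intros H. induction n as [|n IH]; [apply (Clim_const (RtoC 1))|].
  now apply (Clim_mult u).
Qed.

Lemma Clim_RtoC (u : nat -> R) (L : R) : is_lim_seq u L -> Clim (fun n => RtoC (u n)) (RtoC L).
Proof.
  intros H. apply (Clim_le _ _ (fun n => Rabs (u n - L))).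
  - intros n. rewrite <- RtoC_minus, Cmod_R. lra.
  - replace 0 with (Rabs (L - L)) by (rewrite Rminus_diag, Rabs_R0; easy).
    apply (is_lim_seq_abs _ (L - L)).
    apply is_lim_seq_minus'; [easy|apply is_lim_seq_const].
Qed.

Lemma Clim_parts (u : nat -> C) (L : C) :
  is_lim_seq (fun n => Re (u n)) (Re L) -> is_lim_seq (fun n => Im (u n)) (Im L) ->
  Clim u L.
Proof.
  intros HR HI.
  pose proof (Clim_plus _ _ _ _ (Clim_RtoC _ _ HR)
    (Clim_mult _ _ _ _ (Clim_const Ci) (Clim_RtoC _ _ HI))) as H.
  assert (E : forall z, (RtoC (Re z) + Ci * RtoC (Im z))%C = z).
  { intros z. apply C_eq; simpl; ring. }
  rewrite E in H. revert H. apply is_lim_seq_ext. intros n. now rewrite E.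
Qed.

Lemma Clim_zero (u : nat -> C) (L : C) :
  Clim u L -> (forall n, u n = RtoC 0) -> L = RtoC 0.
Proof.
  intros H H0. apply Cmod_eq_0.
  apply (is_lim_seq_ext _ (fun _ => Cmod L)) in H.
  - pose proof (is_lim_seq_unique _ _ H) as E. rewrite Lim_seq_const in E.
    now injection E.
  - intros n. rewrite H0. replace (RtoC 0 - L)%C with (- L)%C by ring. apply Cmod_opp.
Qed.

Lemma Clim_Cmod_le (u : nat -> C) (L : C) (r : R) :
  Clim u L -> (forall n, Cmod (u n) <= r) -> Cmod L <= r.
Proof.
  intros H Hr.
  assert (K : is_lim_seq (fun n => Cmod (u n - L)%C + r) (0 + r)).
  { apply is_lim_seq_plus'; [easy|apply is_lim_seq_const]. }
  rewrite Rplus_0_l in K.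
  apply (is_lim_seq_le (fun _ => Cmod L) _ (Cmod L) r) with (2 := is_lim_seq_const _) (3 := K).
  intros n. replace L with (- (u n - L) + u n)%C at 1 by ring.
  eapply Rle_trans; [apply Cmod_triangle|]. rewrite Cmod_opp. specialize (Hr n). lra.
Qed.

Lemma Clim_Csum (u : nat -> nat -> C) (v : nat -> C) (N : nat) :
  (forall n, Clim (fun j => u j n) (v n)) -> Clim (fun j => Csum (u j) N) (Csum v N).
Proof.
  intros H. induction N as [|N IH]; [apply (Clim_const (RtoC 0))|].
  now apply (Clim_plus (fun j => Csum (u j) N) (fun j => u j N)).
Qed.

Lemma CSeries_incr_n (u : nat -> C) (N : nat) :
  summable u ->
  summable (fun n => u (N + n)%nat) /\
  CSeries u = (Csum u N + CSeries (fun n => u (N + n)%nat))%C.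
Proof.
  intros Hu. induction N as [|N [I1 I2]].
  - split; [exact Hu|]. simpl. ring_simplify. easy.
  - assert (E : forall n, u (N + S n)%nat = u (S N + n)%nat) by (intros; f_equal; lia).
    split.
    + apply (summable_ext _ _ E). exact (proj1 (summable_incr_1 _) I1).
    + rewrite I2, (CSeries_incr_1 _ I1), Nat.add_0_r, (CSeries_ext _ _ E). simpl. ring.
Qed.

(** Dominated convergence: cut where the tail of M is below eps/4. Both tails are then below eps/4,
    and so is the difference of the finite heads for large j. *)
Lemma Tannery (u : nat -> nat -> C) (v : nat -> C) (M : nat -> R) :
  ex_series M -> (forall j n, Cmod (u j n) <= M n) ->
  (forall n, Clim (fun j => u j n) (v n)) ->
  Clim (fun j => CSeries (u j)) (CSeries v).
Proof.
  intros HM Hu Hl.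
  assert (Hv : forall n, Cmod (v n) <= M n).
  { intros n. apply (Clim_Cmod_le _ _ _ (Hl n)). intros j. apply Hu. }
  assert (M0 : forall n, 0 <= M n).
  { intros n. eapply Rle_trans; [apply Cmod_ge_0|apply (Hu O)]. }
  assert (Su : forall j, summable (u j)) by (intros j; now apply (summable_le _ M)).
  assert (Sv : summable v) by now apply (summable_le _ M).
  apply is_lim_seq_spec. intros eps.
  assert (HT : is_lim_seq (fun N => Series M - sum_n M N) (Series M - Series M)).
  { apply is_lim_seq_minus'; [apply is_lim_seq_const|exact (Series_correct M HM)]. }
  rewrite Rminus_diag in HT.
  destruct (proj2 (is_lim_seq_spec _ _) HT (mkposreal (eps / 4) ltac:(destruct eps; simpl; lra)))
    as [N0 HN0].
  specialize (HN0 N0 (Nat.le_refl _)). simpl in HN0.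
  set (N := S N0).
  assert (Tail : forall w, (forall n, Cmod (w n) <= M n) -> summable w ->
    Cmod (CSeries (fun n => w (N + n)%nat)) <= Series M - sum_n M N0).
  { intros w Hw Sw. destruct (CSeries_incr_n w N Sw) as [I1 _].
    eapply Rle_trans; [apply Cmod_CSeries_le, I1|].
    pose proof (Series_incr_n M N ltac:(unfold N; lia) HM) as E.
    simpl pred in E. rewrite <- sum_n_Reals in E. rewrite E.
    match goal with |- _ <= ?a + ?b - ?a => replace (a + b - a) with b by ring end.
    apply Series_le.
    - intros n. split; [apply Cmod_ge_0|apply Hw].
    - now apply (ex_series_incr_n M N). }
  pose proof (Clim_Csum u v N Hl) as HC.
  pose proof (proj2 (is_lim_seq_spec _ _) HC
    (mkposreal (eps / 4) ltac:(destruct eps; simpl; lra))) as HC'.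
  revert HC'. apply filter_imp. intros j Hj. simpl in Hj.
  rewrite Rminus_0_r in Hj, HN0 |- *.
  rewrite Rabs_pos_eq in Hj |- * by apply Cmod_ge_0.
  apply Rabs_lt_between in HN0.
  destruct (CSeries_incr_n (u j) N (Su j)) as [_ ->].
  destruct (CSeries_incr_n v N Sv) as [_ ->].
  pose proof (Tail (u j) (Hu j) (Su j)) as T1. pose proof (Tail v Hv Sv) as T2.
  match goal with |- Cmod (?a + ?b - (?c + ?d))%C < _ =>
    replace (a + b - (c + d))%C with ((a - c) + (b + - d))%C by ring;
    pose proof (Cmod_triangle (a - c) (b + - d)) as Q1;
    pose proof (Cmod_triangle b (- d)) as Q2; rewrite Cmod_opp in Q2 end.
  destruct eps as [e He]; simpl in *. lra.
Qed.

Lemma Abel_seq (a : nat -> R) (t : nat -> R) :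
  ex_series a -> (forall j, 0 < t j < 1) -> is_lim_seq t 1 ->
  is_lim_seq (fun j => Series (fun n => a n * t j ^ n)) (Series a).
Proof.
  intros Ha Ht Hl.
  assert (H1 : ex_pseries a 1) by now apply ex_pseries_1.
  assert (HR : Rbar_le 1 (CV_radius a)).
  { apply CV_radius_ge; [lra|]. exact (proj1 (ex_pseries_R a 1) H1). }
  rewrite <- PSeries_1.
  (* If the radius exceeds 1, the sum is continuous at 1. If it equals 1, Abel's theorem applies,
     and t j < 1 places the sequence in [at_left 1]. *)
  destruct (Rbar_le_lt_or_eq_dec _ _ HR) as [HR'|HR'].
  - apply (is_lim_seq_continuous (PSeries a)); [|easy].
    apply PSeries_continuity. now rewrite Rabs_R1.
  - pose proof (Abel a) as A. rewrite <- HR' in A. simpl in A.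
    specialize (A Rlt_0_1 I H1).
    apply (filterlim_comp _ _ _ t (PSeries a) _ (at_left 1) _); [|exact A].
    intros P [d Hd].
    destruct (proj2 (is_lim_seq_spec _ _) Hl d) as [N HN].
    exists N. intros n Hn. apply Hd; [apply (HN n Hn)|apply Ht].
Qed.

(** * The Bring radical on its closed disc *)

Definition bring (nu : nat) (z : C) : C := CSeries (fun n => RtoC (beta nu n) * z ^ n)%C.

Lemma BR_bring (nu : nat) (a : C) : (1 < nu)%nat -> BR nu a = (/ bring nu (- a))%C.
Proof.
  intros Hnu. unfold BR, bring. f_equal. apply CSeries_ext. intros n.
  unfold BR_term. now rewrite BR_coef_beta.
Qed.

(** The case a = 1, b = 0, s = z of the equation for V; the exponent q is then a placeholder and is
    set to [k1 nu]. *)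
Lemma bring_eq (nu : nat) (z : C) : (1 < nu)%nat ->
  summable (fun n => RtoC (beta nu n) * z ^ n)%C ->
  (bring nu z ^ (nu - 1) = RtoC 1 + z * bring nu z ^ nu)%C.
Proof.
  intros Hnu Hs.
  assert (H : 1 < INR nu) by (apply (lt_INR 1); easy).
  assert (E : forall n, (RtoC (beta nu n) * z ^ n)%C =
    (Vhom (k1 nu) (k1 nu) (RtoC 1) (RtoC 0) n (/ (INR nu - 1)) * z ^ n)%C).
  { intros n. now rewrite Vhom_single. }
  pose proof (Vsum_root (k1 nu) (k1 nu) (RtoC 1) (RtoC 0) z (/ (INR nu - 1)) (nu - 1) nu nu)
    as R.
  unfold bring. rewrite (CSeries_ext _ _ E). fold (Vsum (k1 nu) (k1 nu) (RtoC 1) (RtoC 0)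
    (/ (INR nu - 1)) z). rewrite R.
  - ring.
  - rewrite minus_INR by lia. simpl (INR 1). field. lra.
  - easy.
  - easy.
  - exact (summable_ext _ _ E Hs).
Qed.

Lemma beta_summable_disc (nu : nat) (t : R) : (1 < nu)%nat -> 0 <= t ->
  ex_series (fun n => beta nu n * t ^ n) ->
  forall z, Cmod z <= t -> summable (fun n => RtoC (beta nu n) * z ^ n)%C.
Proof.
  intros Hnu Ht H z Hz. apply (summable_le _ (fun n => beta nu n * t ^ n)); [|easy].
  intros n. rewrite Cmod_mult, Cmod_pow, Cmod_R, Rabs_pos_eq by now apply beta_nonneg.
  apply Rmult_le_compat_l; [now apply beta_nonneg|].
  apply pow_incr. split; [apply Cmod_ge_0|easy].
Qed.

(* Y^(nu-1) = 1 + t Y^nu with Y >= 1 forces t Y <= 1. *)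
Lemma beta_Series_bound (nu : nat) (t : R) : (1 < nu)%nat -> 0 <= t ->
  ex_series (fun n => beta nu n * t ^ n) ->
  let Y := Series (fun n => beta nu n * t ^ n) in 1 <= Y /\ t * Y <= 1.
Proof.
  intros Hnu Ht H Y.
  assert (H0 : forall n, 0 <= beta nu n * t ^ n).
  { intros n. apply Rmult_le_pos; [now apply beta_nonneg|now apply pow_le]. }
  assert (Y1 : 1 <= Y).
  { pose proof (term_le_Series _ 0 H0 H) as Q. unfold beta at 1, Vcoef in Q.
    simpl in Q. unfold Y. lra. }
  split; [easy|].
  pose proof (beta_summable_disc nu t Hnu Ht H (RtoC t)) as Hs.
  rewrite Cmod_R, Rabs_pos_eq in Hs by easy. specialize (Hs (Rle_refl _)).
  assert (EY : bring nu (RtoC t) = RtoC Y).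
  { unfold bring. apply C_eq; rewrite ?Re_CSeries, ?Im_CSeries.
    - apply Series_ext. intros n. now rewrite <- RtoC_pow, <- RtoC_mult.
    - rewrite (Series_ext _ (fun n => 0 * 0)); [rewrite Series_scal_l; simpl; ring|].
      intros n. rewrite <- RtoC_pow, <- RtoC_mult. simpl. ring. }
  pose proof (bring_eq nu (RtoC t) Hnu Hs) as R. rewrite EY in R.
  rewrite <- !RtoC_pow, <- RtoC_mult, <- RtoC_plus in R. apply RtoC_inj in R.
  replace nu with (S (nu - 1)) in R at 2 by lia. simpl in R.
  assert (P : 0 < Y ^ (nu - 1)) by (apply pow_lt; lra).
  apply Rmult_le_reg_r with (Y ^ (nu - 1)); [easy|]. lra.
Qed.

(** Half of the radius 1/exp 3 that the crude estimate gives for |a| + |b| = 1; the geometric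
    majorant then has ratio 1/2. *)
Definition small_radius : R := / (2 * exp 3).

Lemma small_radius_pos : 0 < small_radius.
Proof. apply Rinv_0_lt_compat. pose proof (exp_pos 3). lra. Qed.

(** Inside the disc Y >= 1 and t Y <= 1 force t <= 1, so the radius R0 is finite. The partial sums
    at R0 are limits of those at t < R0, which are at most 1/t; as the terms are nonnegative, the
    series converges at R0. *)
Lemma BR_radius (nu : nat) : (1 < nu)%nat ->
  exists R0, CV_radius (BR_coef nu) = Finite R0 /\ small_radius < R0 /\
    ex_series (fun n => beta nu n * R0 ^ n).
Proof.
  intros Hnu. rewrite (CV_radius_ext _ (beta nu) (fun n => BR_coef_beta nu n Hnu)).
  pose proof small_radius_pos as Hsp. pose proof (exp_pos 3) as He.
  assert (Lo : Rbar_le (3 / 2 * small_radius) (CV_radius (beta nu))).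
  (* At 3/2 of [small_radius] the majorant has ratio 3/4; the surplus makes the lower bound on R0
     strict. *)
  { apply CV_radius_ge; [lra|].
    pose proof (Vsummable_small (k1 nu) (k1 nu) (RtoC 1) (RtoC 0) (/ (INR nu - 1))
      (RtoC (3 / 2 * small_radius)) (k1_bounds nu Hnu) (k1_bounds nu Hnu)) as S.
    rewrite Cmod_1, Cmod_0, Cmod_R, Rabs_pos_eq in S by lra.
    apply summable_Re in S.
    - revert S. apply ex_series_ext. intros n.
      now rewrite Vhom_single, <- RtoC_pow, <- RtoC_mult.
    - unfold small_radius.
      replace (exp 3 * (1 + 0) * (3 / 2 * / (2 * exp 3))) with (3 / 4) by (field; lra). lra. }
  assert (Inside : forall t, 0 <= t -> Rbar_lt t (CV_radius (beta nu)) ->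
     ex_series (fun n => beta nu n * t ^ n)).
  { intros t Ht Hlt. apply ex_series_Rabs, CV_disk_inside. now rewrite Rabs_pos_eq. }
  assert (Up : forall t, 1 < t -> ~ Rbar_lt t (CV_radius (beta nu))).
  { intros t Ht Hlt.
    destruct (beta_Series_bound nu t Hnu ltac:(lra) (Inside t ltac:(lra) Hlt)) as [Y1 Y2].
    assert (t * 1 <= t * Series (fun n => beta nu n * t ^ n))
      by (apply Rmult_le_compat_l; lra). lra. }
  destruct (CV_radius (beta nu)) as [R0| |] eqn:ER; simpl in Lo.
  2:{ exfalso. apply (Up 2); [lra|easy]. }
  2:{ easy. }
  exists R0. split; [easy|]. split; [lra|].
  assert (Hb : forall n, 0 <= beta nu n) by (intros; now apply beta_nonneg).
  apply (ex_series_nonneg_bounded _ (/ small_radius)).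
  - intros n. apply Rmult_le_pos; [easy|apply pow_le; lra].
  - intros N.
    (* Approaches R0 from below by steps of at most a quarter of [small_radius], so it stays above
       [small_radius] and the bound 1/t is uniform. *)
    set (t := fun j => R0 + - small_radius / 4 * / (INR j + 1)).
    assert (Hinv : forall j, 0 < / (INR j + 1) <= 1).
    { intros j. pose proof (pos_INR j). split; [apply Rinv_0_lt_compat; lra|].
      rewrite <- Rinv_1 at 2. apply Rinv_le_contravar; lra. }
    assert (Ht : forall j, small_radius < t j < R0).
    { intros j. unfold t. specialize (Hinv j).
      assert (0 < small_radius / 4 * / (INR j + 1)) by (apply Rmult_lt_0_compat; lra).
      assert (small_radius / 4 * / (INR j + 1) <= small_radius / 4 * 1)
        by (apply Rmult_le_compat_l; lra). lra. }
    assert (Hl : is_lim_seq t R0).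
    { replace (Finite R0) with (Finite (R0 + - small_radius / 4 * 0)) by (f_equal; ring).
      apply is_lim_seq_plus'; [apply is_lim_seq_const|].
      apply is_lim_seq_mult'; [apply is_lim_seq_const|].
      apply (is_lim_seq_ext (fun n => 0 + / (INR n + 1))); [intros; ring|].
      apply is_lim_seq_approach. }
    assert (Hp : forall n, is_lim_seq (fun j => t j ^ n) (R0 ^ n)).
    { induction n as [|n IH]; [apply is_lim_seq_const|].
      now apply (is_lim_seq_mult' t). }
    assert (HN : is_lim_seq (fun j => sum_n (fun n => beta nu n * t j ^ n) N)
                            (sum_n (fun n => beta nu n * R0 ^ n) N)).
    { induction N as [|N IH].
      - rewrite sum_O. apply (is_lim_seq_ext (fun j => beta nu 0 * t j ^ 0)).
        + intros j. now rewrite sum_O.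
        + apply is_lim_seq_mult'; [apply is_lim_seq_const|apply Hp].
      - rewrite sum_Sn. apply (is_lim_seq_ext
          (fun j => sum_n (fun n => beta nu n * t j ^ n) N + beta nu (S N) * t j ^ S N)).
        + intros j. now rewrite sum_Sn.
        + apply is_lim_seq_plus'; [exact IH|].
          apply is_lim_seq_mult'; [apply is_lim_seq_const|apply Hp]. }
    apply (is_lim_seq_le _ (fun _ => / small_radius) _ _) with (2 := HN)
      (3 := is_lim_seq_const _).
    intros j. specialize (Ht j).
    assert (Hex : ex_series (fun n => beta nu n * t j ^ n)).
    { apply Inside; [lra|]. simpl. lra. }
    destruct (beta_Series_bound nu (t j) Hnu ltac:(lra) Hex) as [Y1 Y2].
    eapply Rle_trans; [apply sum_n_le_Series; [|exact Hex]|].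
    + intros n. apply Rmult_le_pos; [easy|apply pow_le; lra].
    + apply Rmult_le_reg_l with small_radius; [easy|].
      rewrite Rinv_r by lra. eapply Rle_trans; [|exact Y2].
      apply Rmult_le_compat_r; lra.
Qed.

(* (x^n - y^n) / (x - y) *)
Fixpoint geo (n : nat) (x y : C) : C :=
  match n with
  | O => RtoC 0
  | S n => (x ^ n + y * geo n x y)%C
  end.

Lemma geo_spec (n : nat) (x y : C) : (x ^ n - y ^ n = (x - y) * geo n x y)%C.
Proof.
  induction n as [|n IH]; simpl; [ring|].
  replace (x * x ^ n - y * y ^ n)%C with ((x - y) * x ^ n + y * (x ^ n - y ^ n))%C by ring.
  rewrite IH. ring.
Qed.

Lemma geo_1 (n : nat) : geo n (RtoC 1) (RtoC 1) = RtoC (INR n).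
Proof.
  induction n as [|n IH]; [easy|].
  rewrite S_INR, RtoC_plus. cbn [geo]. rewrite IH, Cpow_1_l. ring.
Qed.

Lemma analytic_at_geo (F G : R -> C) (t0 : R) (n : nat) :
  analytic_at F t0 -> analytic_at G t0 -> analytic_at (fun t => geo n (F t) (G t)) t0.
Proof.
  intros HF HG. induction n as [|n IH]; [apply (analytic_at_const (RtoC 0))|].
  apply analytic_at_plus; [now apply analytic_at_pow|now apply analytic_at_mult].
Qed.

(** * Continuation along the segment *)

(* g nu mu (t k) (t l) for t <> 0, and its limit 0 at t = 0, as a power series in t. *)
Definition gpath (nu mu : nat) (k l : C) (t : R) : C :=
  (RtoC t * l + RtoC t * (l * RtoC (lambda1 nu mu))
     * CSeries (fun s => g_term nu mu k l s * RtoC t ^ s))%C.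

Lemma gpath_g (nu mu : nat) (k l : C) (t : R) : t <> 0 -> l <> RtoC 0 ->
  gpath nu mu k l t = g nu mu (RtoC t * k) (RtoC t * l).
Proof.
  intros Ht Hl. unfold gpath, g.
  rewrite (CSeries_ext (g_term nu mu (RtoC t * k) (RtoC t * l)) _
    (fun s => g_term_scale nu mu k l t s Ht Hl)). ring.
Qed.

Lemma gpath_0 (nu mu : nat) (k l : C) : gpath nu mu k l 0 = RtoC 0.
Proof. unfold gpath. ring. Qed.

(** Convergence at 1 bounds the radii of the real and the imaginary coefficient series below by 1,
    and inside the disc convergence is absolute. *)
Lemma ex_Cseries_disc (c : nat -> C) (z : C) :
  ex_Cseries c -> Cmod z < 1 -> summable (fun n => c n * z ^ n)%C.
Proof.
  intros Hc Hz. apply ex_Cseries_iff in Hc. destruct Hc as [HR HI].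
  pose proof (Cmod_ge_0 z) as H0.
  assert (A : forall a : nat -> R, ex_series a -> ex_series (fun n => Rabs (a n * Cmod z ^ n))).
  { intros a Ha. apply CV_disk_inside. rewrite Rabs_pos_eq by easy.
    apply Rbar_lt_le_trans with 1; [easy|]. apply CV_radius_ge; [lra|].
    apply (ex_series_ext a); [|easy]. intros n. rewrite pow1. exact (eq_sym (Rmult_1_r _)). }
  apply (summable_le _ (fun n => Rabs (Re (c n) * Cmod z ^ n) + Rabs (Im (c n) * Cmod z ^ n))).
  - intros n. rewrite Cmod_mult, Cmod_pow, !Rabs_mult,
      (Rabs_pos_eq (Cmod z ^ n)) by now apply pow_le.
    rewrite <- Rmult_plus_distr_r. apply Rmult_le_compat_r; [now apply pow_le|].
    replace (c n) with (RtoC (Re (c n)) + Ci * RtoC (Im (c n)))%C at 1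
      by (apply C_eq; simpl; ring).
    eapply Rle_trans; [apply Cmod_triangle|]. rewrite Cmod_mult, Cmod_Ci, !Cmod_R. lra.
  - apply (ex_series_plus (fun n => Rabs (Re (c n) * Cmod z ^ n))
      (fun n => Rabs (Im (c n) * Cmod z ^ n))); now apply A.
Qed.

Lemma gpath_analytic (nu mu : nat) (k l : C) (t0 : R) :
  ex_Cseries (g_term nu mu k l) -> 0 <= t0 < 1 -> analytic_at (gpath nu mu k l) t0.
Proof.
  intros Hc Ht. unfold gpath.
  apply analytic_at_plus; [apply analytic_at_linear|].
  apply analytic_at_mult; [apply analytic_at_linear|].
  (* The midpoint of t0 and 1 is a radius beyond t0 at which the series still converges
     absolutely. *)
  assert (Hr : Cmod (RtoC ((1 + t0) / 2)) = (1 + t0) / 2)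
    by (rewrite Cmod_R, Rabs_pos_eq; lra).
  apply (analytic_at_compose _ ((1 + t0) / 2)).
  - pose proof (ex_Cseries_disc _ (RtoC ((1 + t0) / 2)) Hc ltac:(lra)) as S.
    revert S. apply ex_series_ext. intros n. now rewrite Cmod_mult, Cmod_pow, Hr.
  - apply (analytic_at_ext (fun t => RtoC t * RtoC 1)%C); [intros; ring|].
    apply analytic_at_linear.
  - rewrite Cmod_R, Rabs_pos_eq; lra.
Qed.

Lemma gpath_Vsum (nu mu : nat) (k l : C) (t : R) :
  (0 < mu)%nat -> (mu < nu)%nat -> l <> RtoC 0 ->
  summable (fun s => g_term nu mu k l s * RtoC t ^ s)%C ->
  Vsummable (k1 nu) (k1 nu + lambda1 nu mu) (- l) (- k) (lambda1 nu mu) (RtoC t) ->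
  gpath nu mu k l t = (RtoC t * (l +
    k * Vsum (k1 nu) (k1 nu + lambda1 nu mu) (- l) (- k) (lambda1 nu mu) (RtoC t)))%C.
Proof.
  intros Hmu Hnu Hl Hs HV. unfold gpath, Vsum.
  rewrite <- (CSeries_scal k) by exact HV.
  rewrite (CSeries_ext (fun m => k * _)%C
    (fun m => (l * RtoC (lambda1 nu mu)) * (g_term nu mu k l m * RtoC t ^ m))%C).
  - rewrite CSeries_scal by easy. ring.
  - intros m. rewrite Cmult_assoc, <- (g_term_Vhom nu mu k l m Hmu Hnu Hl). ring.
Qed.

Section Root.

Variables (nu mu : nat) (k l : C).
Hypotheses (Hmu : (0 < mu)%nat) (Hnu : (mu < nu)%nat) (Hl : l <> RtoC 0).
Hypothesis Hdef : ex_Cseries (g_term nu mu k l).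
Variable R0 : R.
Hypotheses (HR0 : 0 < R0) (Hbeta : ex_series (fun n => beta nu n * R0 ^ n)).
Hypothesis Hpath : forall t, 0 < t < 1 -> Cmod (gpath nu mu k l t) < R0.

(** The candidate for 1/X at the parameters (t k, t l). *)
Let h (t : R) : C := bring nu (- gpath nu mu k l t).

Lemma h_analytic (t : R) : 0 <= t < 1 -> analytic_at h t.
Proof.
  intros Ht. apply (analytic_at_compose (fun n => RtoC (beta nu n)) R0).
  - revert Hbeta. apply ex_series_ext. intros n.
    now rewrite Cmod_R, Rabs_pos_eq by (apply beta_nonneg; lia).
  - apply (analytic_at_ext (fun t => (- RtoC 1) * gpath nu mu k l t)%C); [intros; ring|].
    apply analytic_at_mult; [apply analytic_at_const|now apply gpath_analytic].
  - rewrite Cmod_opp. destruct (Req_dec t 0) as [->|H].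
    + now rewrite gpath_0, Cmod_0.
    + apply Hpath. lra.
Qed.

Lemma h_eq (t : R) : Cmod (gpath nu mu k l t) <= R0 ->
  (h t ^ (nu - 1) = RtoC 1 - gpath nu mu k l t * h t ^ nu)%C.
Proof.
  intros Ht. unfold h. rewrite bring_eq; [ring|lia|].
  apply (beta_summable_disc nu R0); [lia|lra|easy|]. now rewrite Cmod_opp.
Qed.

(* The equation for X = 1/y with (t k, t l) in place of (k, l), multiplied by y^nu. *)
Definition trinomial (t : R) (y : C) : C :=
  (y ^ (nu - 1) + RtoC t * (l * y ^ nu + k * y ^ (nu - mu)) - RtoC 1)%C.

(** Y = V^(1/(nu-1)) solves the trinomial equation by construction. Expressing g through V^lambda1
    shows that Y also solves the Bring equation satisfied by h. Subtracting gives (Y - h) Q = 0 with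
    Q nonzero near 0. *)
Lemma h_near_0 : exists eps, 0 < eps /\ forall t, 0 < t < eps -> trinomial t (h t) = RtoC 0.
Proof.
  assert (H1 : 1 <= INR mu) by (apply (le_INR 1); easy).
  assert (H2 : INR mu + 1 <= INR nu) by (rewrite <- S_INR; apply le_INR; lia).
  set (r := k1 nu). set (q := k1 nu + lambda1 nu mu). set (x0 := / (INR nu - 1)).
  assert (Hr : 0 <= r <= 2) by (apply k1_bounds; lia).
  assert (Hq : 0 <= q <= 2) by now apply k1_lambda1_bounds.
  set (K := exp 3 * (Cmod (- l) + Cmod (- k))).
  assert (HK : 0 <= K).
  { apply Rmult_le_pos; [left; apply exp_pos|].
    pose proof (Cmod_ge_0 (- l)). pose proof (Cmod_ge_0 (- k)). lra. }
  (* This gives K rho < 1 for the powers of V, and rho < 1 even when K = 0, as the series of g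
     requires. *)
  set (rho := / (K + 2)).
  assert (Hrho : 0 < rho < 1).
  { split; [apply Rinv_0_lt_compat; lra|].
    rewrite <- Rinv_1. apply Rinv_lt_contravar; lra. }
  assert (HKr : K * rho < 1).
  { apply Rmult_lt_reg_r with (K + 2); [lra|].
    unfold rho. replace (K * / (K + 2) * (K + 2)) with K by (field; lra). lra. }
  assert (HV : forall x t, Rabs t <= rho -> Vsummable r q (- l) (- k) x (RtoC t)).
  { intros x t Ht. apply Vsummable_small; auto. rewrite Cmod_R.
    apply Rle_lt_trans with (K * rho); [|easy]. now apply Rmult_le_compat_l. }
  set (Y := fun t => Vsum r q (- l) (- k) x0 (RtoC t)).
  assert (Yan : analytic_at Y 0).
  { exists (fun m => Vhom r q (- l) (- k) m x0), rho. split; [lra|]. split.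
    - apply HV. rewrite Rabs_pos_eq; lra.
    - intros s Hs. now rewrite Rplus_0_l. }
  assert (han : analytic_at h 0) by (apply h_analytic; lra).
  assert (Gan : analytic_at (gpath nu mu k l) 0) by (apply gpath_analytic; [easy|lra]).
  (* The difference quotient of y^(nu-1) + g y^nu between Y and h; at t = 0, where g = 0 and Y = h =
     1, it equals nu - 1. *)
  set (Q := fun t => (geo (nu - 1) (Y t) (h t)
                      + gpath nu mu k l t * geo nu (Y t) (h t))%C).
  assert (Qan : analytic_at Q 0).
  { apply analytic_at_plus; [now apply analytic_at_geo|].
    apply analytic_at_mult; [easy|now apply analytic_at_geo]. }
  assert (C0 : forall c : nat -> C, c O = RtoC 1 ->
     CSeries (fun m => c m * RtoC 0 ^ m)%C = RtoC 1).
  { intros c Hc. rewrite (CSeries_finite _ 1).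
    - simpl. rewrite Hc. ring.
    - intros [|n] Hn; [lia|]. simpl. ring. }
  assert (Y0 : Y 0 = RtoC 1) by (apply C0, Vhom_O).
  assert (h0 : h 0 = RtoC 1).
  { unfold h, bring. rewrite gpath_0, Copp_0.
    now apply (C0 (fun n => RtoC (beta nu n))). }
  assert (Q0 : Q 0 <> RtoC 0).
  { unfold Q. rewrite Y0, h0, gpath_0, geo_1. intros E.
    rewrite Cmult_0_l, Cplus_0_r in E. apply RtoC_inj in E.
    rewrite minus_INR in E by lia. simpl in E. lra. }
  destruct (analytic_at_neq_0 Q 0 Qan Q0) as (d & Hd & HQ).
  exists (Rmin rho d). split; [apply Rmin_pos; lra|]. intros t Ht.
  pose proof (Rmin_l rho d). pose proof (Rmin_r rho d).
  assert (At : Rabs t <= rho) by (rewrite Rabs_pos_eq; lra).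
  assert (EY : (Y t ^ (nu - 1)
    = RtoC 1 + RtoC t * (- l * Y t ^ nu + - k * Y t ^ (nu - mu)))%C).
  { refine (Vsum_root r q (- l) (- k) (RtoC t) x0 (nu - 1) nu (nu - mu) _ _ _ _).
    - rewrite minus_INR by lia. unfold x0. simpl (INR 1). field. lra.
    - unfold x0, r, k1. easy.
    - rewrite minus_INR by lia. unfold x0, q, k1, lambda1. field. lra.
    - now apply HV. }
  assert (EG : gpath nu mu k l t = (RtoC t *
     (l + k * Vsum r q (- l) (- k) (lambda1 nu mu) (RtoC t)))%C).
  { apply gpath_Vsum; auto. apply ex_Cseries_disc; [easy|]. rewrite Cmod_R. lra. }
  (* Since lambda1 = -mu x0, the product is V^0; this replaces the division by Y^mu. *)
  assert (EL : (Vsum r q (- l) (- k) (lambda1 nu mu) (RtoC t) * Y t ^ mu = RtoC 1)%C).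
  { unfold Y. destruct (Vsum_INR r q (- l) (- k) x0 (RtoC t) mu (HV _ _ At)) as [S1 <-].
    destruct (Vsum_plus r q (- l) (- k) (lambda1 nu mu) (INR mu * x0) (RtoC t)
      (HV _ _ At) S1) as [_ <-].
    replace (lambda1 nu mu + INR mu * x0) with 0
      by (unfold lambda1, x0; field; lra).
    apply Vsum_0. }
  assert (EGY : (gpath nu mu k l t * Y t ^ nu
    = RtoC t * (l * Y t ^ nu + k * Y t ^ (nu - mu)))%C).
  { rewrite EG. set (V := Vsum _ _ _ _ _ _) in *.
    replace (Y t ^ nu)%C with (Y t ^ mu * Y t ^ (nu - mu))%C
      by (rewrite <- Cpow_add_r; f_equal; lia).
    replace (RtoC t * (l + k * V) * (Y t ^ mu * Y t ^ (nu - mu)))%C with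
      (RtoC t * (l * (Y t ^ mu * Y t ^ (nu - mu)) + k * (V * Y t ^ mu) * Y t ^ (nu - mu)))%C
      by ring.
    rewrite EL. ring. }
  assert (Hh : (h t ^ (nu - 1) = RtoC 1 - gpath nu mu k l t * h t ^ nu)%C).
  { apply h_eq. left. apply Hpath. lra. }
  assert (HYh : ((Y t - h t) * Q t = RtoC 0)%C).
  { unfold Q.
    replace ((Y t - h t) * (geo (nu - 1) (Y t) (h t)
        + gpath nu mu k l t * geo nu (Y t) (h t)))%C
      with ((Y t - h t) * geo (nu - 1) (Y t) (h t)
        + gpath nu mu k l t * ((Y t - h t) * geo nu (Y t) (h t)))%C by ring.
    rewrite <- !geo_spec, Hh, EY.
    replace (gpath nu mu k l t * (Y t ^ nu - h t ^ nu))%C with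
      (gpath nu mu k l t * Y t ^ nu - gpath nu mu k l t * h t ^ nu)%C by ring.
    rewrite EGY. ring. }
  assert (Eh : h t = Y t).
  { specialize (HQ t). rewrite Rplus_0_l in HQ. specialize (HQ ltac:(rewrite Rabs_pos_eq; lra)).
    apply NNPP. intros N. apply (Cmult_neq_0 (Y t - h t) (Q t)); [|easy|easy].
    intros E. apply N. symmetry. now apply Ceq_minus. }
  unfold trinomial. rewrite Eh, EY. ring.
Qed.

Lemma h_trinomial (t : R) : 0 < t < 1 -> trinomial t (h t) = RtoC 0.
Proof.
  destruct h_near_0 as (eps & He & H).
  apply (analytic_identity (fun t => trinomial t (h t)) eps He); [|exact H].
  clear t. intros t Ht.
  assert (A : forall n, analytic_at (fun t => h t ^ n)%C t).
  { intros n. apply analytic_at_pow, h_analytic. lra. }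
  apply (analytic_at_ext (fun t => h t ^ (nu - 1)
    + (RtoC t * RtoC 1) * (l * h t ^ nu + k * h t ^ (nu - mu)) + - RtoC 1)%C).
  { intros s. unfold trinomial. ring. }
  repeat first [apply analytic_at_plus|apply analytic_at_linear|apply A
    |apply analytic_at_const|apply analytic_at_mult].
Qed.

Lemma bring_root : let Y := bring nu (- g nu mu k l) in
  (Y ^ (nu - 1) + (l * Y ^ nu + k * Y ^ (nu - mu)) = RtoC 1)%C.
Proof.
  intros Y.
  (* A sequence inside (0, 1) tending to 1; the factor 1/2 keeps its first member positive. *)
  set (t := fun j => 1 + - / 2 * / (INR j + 1)).
  assert (Ht : forall j, 0 < t j < 1).
  { intros j. unfold t. pose proof (pos_INR j).
    assert (0 < / (INR j + 1)) by (apply Rinv_0_lt_compat; lra).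
    assert (/ (INR j + 1) <= 1); [|lra].
    rewrite <- Rinv_1. apply Rinv_le_contravar; lra. }
  assert (Hlim : is_lim_seq t 1).
  { replace (Finite 1) with (Finite (1 + - / 2 * 0)) by (f_equal; ring).
    apply is_lim_seq_plus'; [apply is_lim_seq_const|].
    apply is_lim_seq_mult'; [apply is_lim_seq_const|].
    apply (is_lim_seq_ext (fun n => 0 + / (INR n + 1))); [intros; ring|].
    apply is_lim_seq_approach. }
  pose proof (Clim_RtoC t 1 Hlim) as Ct.
  assert (G : Clim (fun j => gpath nu mu k l (t j)) (g nu mu k l)).
  { unfold gpath, g.
    replace (l + l * RtoC (lambda1 nu mu) * CSeries (g_term nu mu k l))%C with
      (RtoC 1 * l + RtoC 1 * (l * RtoC (lambda1 nu mu)) * CSeries (g_term nu mu k l))%C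
      by ring.
    apply Clim_plus; [apply Clim_mult; [easy|apply Clim_const]|].
    apply Clim_mult; [apply Clim_mult; [easy|apply Clim_const]|].
    apply ex_Cseries_iff in Hdef. destruct Hdef as [HR HI].
    apply Clim_parts.
    - apply (is_lim_seq_ext (fun j => Series (fun n => Re (g_term nu mu k l n) * t j ^ n))).
      + intros j. rewrite Re_CSeries. apply Series_ext. intros n.
        now rewrite <- RtoC_pow, re_scal_r.
      + now apply Abel_seq.
    - apply (is_lim_seq_ext (fun j => Series (fun n => Im (g_term nu mu k l n) * t j ^ n))).
      + intros j. rewrite Im_CSeries. apply Series_ext. intros n.
        now rewrite <- RtoC_pow, im_scal_r.
      + now apply Abel_seq. }
  assert (HY : Clim (fun j => h (t j)) Y).
  (* The majorant at R0 is summable, so the limit is legitimate even if |g| reaches the boundary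
     value R0. *)
  { apply (Tannery (fun j n => RtoC (beta nu n) * (- gpath nu mu k l (t j)) ^ n)%C
      _ (fun n => beta nu n * R0 ^ n)); [easy| |].
    - intros j n. rewrite Cmod_mult, Cmod_pow, Cmod_opp, Cmod_R.
      rewrite Rabs_pos_eq by (apply beta_nonneg; lia).
      apply Rmult_le_compat_l; [apply beta_nonneg; lia|].
      apply pow_incr. split; [apply Cmod_ge_0|]. left. now apply Hpath.
    - intros n. apply Clim_mult; [apply Clim_const|]. now apply Clim_pow, Clim_opp. }
  apply Ceq_minus.
  apply (Clim_zero (fun j => trinomial (t j) (h (t j)))); [|intros j; now apply h_trinomial].
  unfold trinomial.
  replace (Y ^ (nu - 1) + (l * Y ^ nu + k * Y ^ (nu - mu)) - RtoC 1)%C with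
    (Y ^ (nu - 1) + RtoC 1 * (l * Y ^ nu + k * Y ^ (nu - mu)) + - RtoC 1)%C by ring.
  apply Clim_plus; [|apply Clim_const].
  apply Clim_plus; [now apply Clim_pow|]. apply Clim_mult; [easy|].
  apply Clim_plus; (apply Clim_mult; [apply Clim_const|now apply Clim_pow]).
Qed.

End Root.

(** * From Y back to X, and small parameters *)

Lemma BR_solves (nu mu : nat) (k l : C) : (0 < mu)%nat -> (mu < nu)%nat ->
  l <> RtoC 0 -> X2_defined nu mu k l -> principal_branch nu mu k l ->
  let X := BR nu (g nu mu k l) in (X ^ nu = k * X ^ mu + X + l)%C.
Proof.
  intros Hmu Hnu Hl [Hdef _] Hpb.
  destruct (BR_radius nu ltac:(lia)) as (R0 & ER & HR0 & Hb).
  pose proof small_radius_pos.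
  assert (Hpath : forall t, 0 < t < 1 -> Cmod (gpath nu mu k l t) < R0).
  { intros t Ht. specialize (Hpb t Ht). rewrite ER in Hpb.
    rewrite gpath_g by (auto; lra). exact Hpb. }
  pose proof (bring_root nu mu k l Hmu Hnu Hl Hdef R0 ltac:(lra) Hb Hpath) as E.
  cbv zeta in E |- *. rewrite BR_bring by lia.
  set (Y := bring nu _) in *.
  (* The exponents nu - 1, nu and nu - mu are all positive, so Y = 0 would turn the equation into 0
     = 1. *)
  assert (HY : Y <> RtoC 0).
  { intros K. rewrite K in E. apply C1_nz. rewrite <- E.
    replace (nu - 1)%nat with (S (nu - 2)) by lia.
    replace (nu - mu)%nat with (S (nu - mu - 1)) by lia.
    replace nu with (S (nu - 1)) at 2 by lia. simpl. ring. }
  rewrite !Cpow_inv by easy.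
  assert (P : forall n, (Y ^ n)%C <> RtoC 0) by (intros; now apply Cpow_nz).
  assert (E1 : (Y ^ nu = Y * Y ^ (nu - 1))%C).
  { replace nu with (S (nu - 1)) at 1 by lia. easy. }
  assert (E2 : (Y ^ nu = Y ^ mu * Y ^ (nu - mu))%C).
  { rewrite <- Cpow_add_r. f_equal. lia. }
  replace (/ Y ^ nu)%C with (/ Y ^ nu * RtoC 1)%C by ring. rewrite <- E.
  replace (/ Y ^ nu * (Y ^ (nu - 1) + (l * Y ^ nu + k * Y ^ (nu - mu))))%C with
    (/ Y ^ nu * Y ^ (nu - 1) + l + k * (/ Y ^ nu * Y ^ (nu - mu)))%C by (field; auto).
  rewrite E1 at 1. rewrite E2. field. repeat split; auto.
Qed.

(** Here exp 3 (|k| + |l|) <= 1/2, so the geometric majorant gives |V^lambda1| <= 2 exp |lambda1|.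
    Hence |g| <= |l| + |k| |V^lambda1| < delta (1 + 2 exp |lambda1|), and delta is chosen to make
    this [small_radius]. *)
Lemma small_defined (nu mu : nat) (k l : C) : (0 < mu)%nat -> (mu < nu)%nat ->
  let delta := small_radius / (1 + 2 * exp (Rabs (lambda1 nu mu))) in
  Cmod k < delta -> Cmod l < delta -> l <> RtoC 0 ->
  ex_Cseries (g_term nu mu k l) /\ Cmod (g nu mu k l) < small_radius.
Proof.
  intros Hmu Hnu delta Hk Hl0 Hl.
  set (L := exp (Rabs (lambda1 nu mu))) in *.
  assert (HL : 1 <= L).
  { unfold L. pose proof (exp_ineq1_le (Rabs (lambda1 nu mu))).
    pose proof (Rabs_pos (lambda1 nu mu)). lra. }
  pose proof small_radius_pos as Hs. pose proof (exp_pos 3) as He3.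
  assert (Hd : delta * (1 + 2 * L) = small_radius) by (unfold delta; field; lra).
  assert (Hd0 : 0 < delta) by (apply Rdiv_lt_0_compat; lra).
  pose proof (Cmod_ge_0 k). pose proof (Cmod_ge_0 l).
  set (w := exp 3 * (Cmod (- l) + Cmod (- k))).
  assert (Hw : 0 <= w <= / 2).
  { unfold w. rewrite !Cmod_opp. split; [apply Rmult_le_pos; lra|].
    apply Rle_trans with (exp 3 * small_radius).
    - apply Rmult_le_compat_l; [lra|]. rewrite <- Hd.
      assert (delta * 3 <= delta * (1 + 2 * L)) by (apply Rmult_le_compat_l; lra). lra.
    - right. unfold small_radius. field. lra. }
  pose proof (k1_bounds nu ltac:(lia)) as Hr.
  pose proof (k1_lambda1_bounds nu mu Hmu Hnu) as Hq.
  assert (H1 : 1 <= INR mu) by (apply (le_INR 1); easy).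
  assert (H2 : INR mu + 1 <= INR nu) by (rewrite <- S_INR; apply le_INR; lia).
  assert (Hlam : RtoC (lambda1 nu mu) <> RtoC 0).
  { intros K. apply RtoC_inj in K. revert K.
    unfold lambda1. apply Rmult_integral_contrapositive. split; [lra|].
    apply Rinv_neq_0_compat. lra. }
  assert (HV : Vsummable (k1 nu) (k1 nu + lambda1 nu mu) (- l) (- k) (lambda1 nu mu) (RtoC 1)).
  { apply Vsummable_small; auto. fold w. rewrite Cmod_1. lra. }
  assert (Sg : summable (g_term nu mu k l)).
  { apply (summable_ext (fun m => / (RtoC (lambda1 nu mu) * l) * (k *
      (Vhom (k1 nu) (k1 nu + lambda1 nu mu) (- l) (- k) m (lambda1 nu mu) * RtoC 1 ^ m)))%C).
    - intros m. rewrite Cpow_1_l, Cmult_1_r, <- (g_term_Vhom nu mu k l m Hmu Hnu Hl).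
      field. auto.
    - now apply summable_scal, summable_scal. }
  split; [now apply summable_ex_Cseries|].
  (* The end point t = 1 of the path, where the description of g by V^lambda1 is available. *)
  replace (g nu mu k l) with (gpath nu mu k l 1).
  2:{ rewrite gpath_g by (auto; lra). now rewrite !Cmult_1_l. }
  rewrite gpath_Vsum, Cmult_1_l; auto.
  2:{ apply (summable_ext (g_term nu mu k l)); [|easy]. intros m. rewrite Cpow_1_l. ring. }
  set (V := Vsum _ _ _ _ _ _).
  assert (BV : Cmod V <= 2 * L).
  { eapply Rle_trans; [apply Cmod_CSeries_le, HV|].
    replace (2 * L) with (L * / (1 - / 2)) by field.
    assert (Hh : Rabs (/ 2) < 1) by (rewrite Rabs_pos_eq; lra).
    rewrite <- (Series_geom (/ 2)) by easy. rewrite <- Series_scal_l. apply Series_le.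
    - intros m. split; [apply Cmod_ge_0|].
      rewrite Cpow_1_l, Cmult_1_r. eapply Rle_trans; [apply Vhom_bound; auto|].
      apply Rmult_le_compat_l; [lra|]. now apply pow_incr.
    - apply (ex_series_scal_l L (fun n => (/ 2) ^ n)). now apply ex_series_geom. }
  eapply Rle_lt_trans; [apply Cmod_triangle|]. rewrite Cmod_mult.
  assert (Cmod k * Cmod V <= delta * (2 * L)).
  { apply Rmult_le_compat; auto; [apply Cmod_ge_0|lra]. }
  lra.
Qed.

(** The second conjunct keeps the first from being vacuous: near the origin both the convergence and
    the branch condition hold. *)
Theorem theorem5 (nu mu : nat) (Hmu : (0 < mu)%nat) (Hnu : (mu < nu)%nat) :
  (forall k l : C,
     Cmod k < 1 -> Cmod l < 1 -> l <> RtoC 0 -> Cmod (k * / l)%C < 1 ->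
     X2_defined nu mu k l ->
     principal_branch nu mu k l ->
     let X2 := BR nu (g nu mu k l) in
     (X2 ^ nu = k * X2 ^ mu + X2 + l)%C) /\
  (exists delta : R, 0 < delta /\
     forall k l : C,
       Cmod k < delta -> Cmod l < delta -> l <> RtoC 0 -> Cmod (k * / l)%C < 1 ->
       X2_defined nu mu k l /\ principal_branch nu mu k l).
Proof.
  split.
  - intros k l _ _ Hl _ Hdef Hpb. now apply BR_solves.
  - exists (small_radius / (1 + 2 * exp (Rabs (lambda1 nu mu)))).
    pose proof (exp_pos (Rabs (lambda1 nu mu))).
    split; [apply Rdiv_lt_0_compat; [apply small_radius_pos|lra]|].
    intros k l Hk Hl0 Hl _.
    destruct (BR_radius nu ltac:(lia)) as (R0 & ER & HR0 & Hb).
    destruct (small_defined nu mu k l Hmu Hnu Hk Hl0 Hl) as [D1 D2].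
    split; [split; [easy|]|].
    + apply summable_ex_Cseries.
      apply (summable_ext (fun n => RtoC (beta nu n) * (- g nu mu k l) ^ n)%C).
      * intros n. unfold BR_term. now rewrite BR_coef_beta by lia.
      * pose proof small_radius_pos.
        apply (beta_summable_disc nu R0); [lia|lra|easy|]. rewrite Cmod_opp. lra.
    + intros t Ht. rewrite ER. simpl.
      (* Scaling by t < 1 keeps both parameters below delta, so the bound by [small_radius], which
         is less than R0, holds all along the segment. *)
      assert (Ab : forall z, Cmod (RtoC t * z) <= Cmod z).
      { intros z. rewrite Cmod_mult, Cmod_R, Rabs_pos_eq by lra.
        pose proof (Cmod_ge_0 z). rewrite <- (Rmult_1_l (Cmod z)) at 2.
        apply Rmult_le_compat_r; lra. }
      pose proof (Ab k). pose proof (Ab l).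
      apply Rlt_trans with small_radius; [|easy].
      apply small_defined; auto; try lra.
      apply Cmult_neq_0; [|easy]. intros K. apply RtoC_inj in K. lra.
Qed.
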